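(* For real numbers $1<a<b$ let $f_{a,b}(z)=\sum_{k=0}^\infty a_k z^k$, with $a_k>0$ for all $k\ge 0$, be an entire function such that $q_2(f_{a,b})=q_4(f_{a,b})=q_6(f_{a,b})=\ldots=a$ and $q_3(f_{a,b})=q_5(f_{a,b})=q_7(f_{a,b})=\ldots=b$, where $q_n(f_{a,b})=\frac{a_{n-1}^2}{a_{n-2}a_n}$ for $n\ge 2$. Then the following statements are valid. 1. If $f_{a,b}$ belongs to the Laguerre--Pólya class of type I, then $a\ge q_\infty$. 2. If the numbers $a,b$ with $q_\infty\le a<b$ are such that $f_{a,b}\in\mathcal{L-P}I$, then for every $c$ with $a<c<b$ we have $f_{a,c}\in\mathcal{L-P}I$. 3. If the numbers $a,b$ with $q_\infty\le a<b$ are such that $f_{a,b}\in\mathcal{L-P}$, then for every $d$ with $a<d<b$ we have $f_{d,b}\in\mathcal{L-P}I$.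
   Context: A real entire function $f$ belongs to the Laguerre--Pólya class (written $f\in\mathcal{L-P}$) if it can be expressed in the form $f(z)=c z^n e^{-\alpha z^2+\beta z}\prod_{k}\left(1-\frac{z}{x_k}\right)e^{z x_k^{-1}}$, where $c,\alpha,\beta,x_k\in\mathbb{R}$, $x_k\ne 0$, $\alpha\ge 0$, $n$ is a nonnegative integer and $\sum_k x_k^{-2}<\infty$. A real entire function $f$ belongs to the Laguerre--Pólya class of type I (written $f\in\mathcal{L-P}I$) if it can be expressed in the form $f(z)=c z^n e^{\beta z}\prod_{k}\left(1+\frac{z}{x_k}\right)$, where $c\in\mathbb{R}$, $\beta\ge 0$, $x_k>0$, $n$ is a nonnegative integer, and $\sum_k x_k^{-1}<\infty$. In both definitions the product may be infinite, finite, or empty (in the latter case it equals 1). The function $f_{a,b}$ is determined by $a$, $b$ and its first two coefficients $a_0,a_1>0$. Different choices of $a_0,a_1$ give functions differing only by a positive constant factor and a positive rescaling of the variable, so membership in $\mathcal{L-P}$ or $\mathcal{L-P}I$ depends only on $(a,b)$. The constant $q_\infty\approx 3.23363666\ldots$ is defined as follows. For $s>1$ let $g_s(z)=\sum_{k=0}^\infty z^k s^{-k^2}$ be the partial theta function. It is known (Katkova, Lobova, Vishnyakova) that there is a unique constant $q_\infty$ such that, for $s>1$, $g_s\in\mathcal{L-P}$ if and only if $s^2\ge q_\infty$. It is also known that $g_s\in\mathcal{L-P}$ if and only if there exists $z_0\in(-s^3,-s)$ with $g_s(z_0)\le 0$. *)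

(* Defs.v *)
From Stdlib Require Export Reals.
From Coquelicot Require Export Coquelicot.

Open Scope R_scope.

(** [C] is Coquelicot's field of complex numbers, [RtoC : R -> C] the coercion. *)

Definition Cexp (z : C) : C :=
  (exp (Re z) * cos (Im z), exp (Re z) * sin (Im z)).

(** The sum of a convergent complex series, taken componentwise
    ([Series] is total; its value is junk on divergent series). *)
Definition CSeries (a : nat -> C) : C :=
  (Series (fun k => Re (a k)), Series (fun k => Im (a k))).

Fixpoint Cprod (F : nat -> C) (n : nat) : C :=
  match n with
  | O => RtoC 1
  | S m => Cmult (Cprod F m) (F m)
  end.

(** The factors of a product are indexed by [k < n] when [N = Some n]
    (the product is finite, and empty for [n = 0]) and by all [k : nat]
    when [N = None] (the product is infinite). *)
Definition in_range (N : option nat) (k : nat) : Prop :=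
  match N with Some n => (k < n)%nat | None => True end.

Definition summable (N : option nat) (t : nat -> R) : Prop :=
  match N with Some _ => True | None => ex_series t end.

Definition is_product (N : option nat) (F : nat -> C) (P : C) : Prop :=
  match N with
  | Some n => P = Cprod F n
  | None => filterlim (Cprod F) eventually (locally P)
  end.

(** [f] is the sum, on the whole plane, of the power series with real
    coefficients [u]. *)
Definition is_entire_series (u : nat -> R) (f : C -> C) : Prop :=
  forall z : C,
    is_series (K := C_AbsRing) (V := C_NormedModule)
      (fun k => Cmult (RtoC (u k)) (Cpow z k)) (f z).

Definition real_entire (f : C -> C) : Prop :=
  exists u : nat -> R, is_entire_series u f.

Definition LP (f : C -> C) : Prop :=
  real_entire f /\
  exists (c alpha beta : R) (n : nat) (N : option nat) (x : nat -> R),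
    0 <= alpha /\
    (forall k, in_range N k -> x k <> 0) /\
    summable N (fun k => / (x k) ^ 2) /\
    forall z : C, exists P : C,
      is_product N (fun k => (1 - z / x k) * Cexp (z * / x k))%C P /\
      f z = (c * Cpow z n * Cexp (- alpha * Cpow z 2 + beta * z) * P)%C.

Definition LPI (f : C -> C) : Prop :=
  real_entire f /\
  exists (c beta : R) (n : nat) (N : option nat) (x : nat -> R),
    0 <= beta /\
    (forall k, in_range N k -> 0 < x k) /\
    summable N (fun k => / x k) /\
    forall z : C, exists P : C,
      is_product N (fun k => 1 + z / x k)%C P /\
      f z = (c * Cpow z n * Cexp (beta * z) * P)%C.

(** The second quotients [q_n], meaningful for [n >= 2]. *)
Definition second_quotient (u : nat -> R) (n : nat) : R :=
  u (n - 1)%nat ^ 2 / (u (n - 2)%nat * u n).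

(** [f] is one of the functions [f_{a,b}]; they differ by the choice of the
    first two coefficients. *)
Definition is_f_ab (a b : R) (f : C -> C) : Prop :=
  exists u : nat -> R,
    (forall k, 0 < u k) /\
    is_entire_series u f /\
    (forall m, (1 <= m)%nat -> second_quotient u (2 * m) = a) /\
    (forall m, (1 <= m)%nat -> second_quotient u (2 * m + 1) = b).

Definition partial_theta (s : R) (z : C) : C :=
  CSeries (fun k => (Cpow z k * / RtoC (s ^ (k ^ 2)))%C).

(** The property that determines the constant [q_infty = 3.23363666...]. *)
Definition is_q_infty (q : R) : Prop :=
  forall s : R, 1 < s -> (LP (partial_theta s) <-> q <= s ^ 2).

(* Main.v *)
Require Import Defs.
From Stdlib Require Import Lra Lia Psatz ClassicalEpsilon List.
Open Scope R_scope.

(** After multiplication by a constant and rescaling of the variable, the coefficients of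
    [f_{a,b}] depend on [a] and [b] only and begin with [1, 1, 1/a, 1/(a^2 b)]. The proof
    characterises membership by the sign of one value: [f_{a,b}] belongs to the class when
    [f_{a,b}(- x) <= 0] for some [x] with [1 < x < a]. The condition is expressed by
    [negative_sums a b x]: all the sums of an even number of terms of the alternating series
    at [- x] are negative.

    The condition is necessary ([negative_sums_of_LP]). A function of the Laguerre-Polya
    class with [f(0) > 0] satisfies [f(t) <= f(0) exp (B t)] as long as no zero lies between
    [0] and [t], since [(1 - y) exp y <= 1] ([LP_le_exp]). Looking near [0], the normalised
    function has [B >= 1], and [a >= 2]. If it had no zero in [[- a, 0)], its value at [- a]
    would be at most [exp (- a)]; but the series shows that it is larger
    ([exp_neg_lt_altsum_3]). So there is a zero [- x], and the series forces [1 < x < a].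

    The condition is sufficient when [2 <= a <= b] ([LPI_of_negative_sums]). The quotients
    have period two, so near the index [2m] the terms at [x (ab)^m] copy the terms at [x], and
    the alternating sums there are negative. Read backwards, the sequence of quotients
    exchanges [a] and [b], and the condition for [(b, a)], which follows from the one for
    [(a, b)], makes the sums at [(ab)^m / x] positive. A truncation of degree [2n + 1] thus
    changes sign [2n + 1] times, and all its roots are real and negative, in intervals that
    do not depend on [n]. The inverses of these intervals' endpoints are summable, so a
    cluster point of the inverse roots represents the limit as an infinite product
    ([product_of_negative_sums]).

    The condition is monotone ([altsum_le_of_lower_first], [altsum_le_of_lower_second]):
    for fixed [x], the alternating sums decrease when [a] increases to [d], and when [b]
    decreases to some [c >= a]. This gives the second and the third claim. For [c = a] the
    function is a partial theta function, whose membership in the class means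
    [q_infty <= a]; this is the first claim. *)

(** * Coefficients with alternating second quotients *)

Definition quotient (a b : R) (k : nat) : R := if Nat.even k then a else b.

(** The quotients [coef k / coef (k + 1)], that is [1, a, ab, a(ab), (ab)^2, ...]: the
    moduli at which the dominant term of the series changes. *)
Fixpoint ratio (a b : R) (k : nat) : R :=
  match k with O => 1 | S j => ratio a b j * quotient a b j end.

(** The coefficients of [f_{a,b}] when the first two are [1]. *)
Fixpoint coef (a b : R) (k : nat) : R :=
  match k with O => 1 | S j => coef a b j / ratio a b j end.

Definition term (a b x : R) (k : nat) : R := coef a b k * x ^ k.

(** The series at [- x] is summed two terms at a time: the second quotients have period
    two, and the truncations that end with an odd power are the ones that approach the
    value of the series from below. *)
Definition pair_diff (a b x : R) (i : nat) : R :=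
  term a b x (2 * i) - term a b x (2 * i + 1).

Fixpoint Rsum (f : nat -> R) (n : nat) : R :=
  match n with O => 0 | S m => Rsum f m + f m end.

Definition altsum (a b x : R) (N : nat) : R := Rsum (pair_diff a b x) N.

(** The form in which the existence of a point [- x] with [f_{a,b}(- x) <= 0] is used. It
    involves finite sums only, so it passes directly to polynomials, and it is monotone in
    [a] and [b]. *)
Definition negative_sums (a b x : R) : Prop :=
  forall N, (1 <= N)%nat -> altsum a b x N < 0.

Lemma Rsum_ext f g n : (forall i, (i < n)%nat -> f i = g i) -> Rsum f n = Rsum g n.
Proof.
  induction n as [|n IH]; intros H; simpl; [reflexivity|].
  rewrite IH, H by auto; reflexivity.
Qed.

Lemma Rsum_le f g n : (forall i, (i < n)%nat -> f i <= g i) -> Rsum f n <= Rsum g n.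
Proof.
  induction n as [|n IH]; intros H; simpl; [lra|].
  assert (f n <= g n) by auto. assert (Rsum f n <= Rsum g n) by auto. lra.
Qed.

Lemma Rsum_scal c f n : Rsum (fun i => c * f i) n = c * Rsum f n.
Proof. induction n as [|n IH]; simpl; [|rewrite IH]; ring. Qed.

Lemma Rsum_minus f g n : Rsum (fun i => f i - g i) n = Rsum f n - Rsum g n.
Proof. induction n as [|n IH]; simpl; [|rewrite IH]; ring. Qed.

Lemma Rsum_split f m n : Rsum f (m + n) = Rsum f m + Rsum (fun i => f (m + i)%nat) n.
Proof.
  induction n as [|n IH]; simpl.
  - rewrite Nat.add_0_r; ring.
  - rewrite Nat.add_succ_r; simpl; rewrite IH; ring.
Qed.

Lemma Rsum_nonneg f n : (forall i, (i < n)%nat -> 0 <= f i) -> 0 <= Rsum f n.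
Proof.
  induction n as [|n IH]; intros H; simpl; [lra|].
  assert (0 <= f n) by auto. assert (0 <= Rsum f n) by auto. lra.
Qed.

Lemma Rsum_nonpos f n : (forall i, (i < n)%nat -> f i <= 0) -> Rsum f n <= 0.
Proof.
  induction n as [|n IH]; intros H; simpl; [lra|].
  assert (f n <= 0) by auto. assert (Rsum f n <= 0) by auto. lra.
Qed.

Lemma Rsum_rev f n : Rsum f (S n) = Rsum (fun i => f (n - i)%nat) (S n).
Proof.
  induction n as [|n IH]; [reflexivity|].
  rewrite (Rsum_split (fun i => f (S n - i)%nat) 1 (S n)
           : Rsum _ (S (S n)) = _).
  change (Rsum f (S n) + f (S n) = 0 + f (S n) + Rsum (fun i => f (n - i)%nat) (S n)).
  rewrite IH; ring.
Qed.

(** * Ratios of consecutive coefficients *)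

Lemma ratio_even a b m : ratio a b (2 * m) = (a * b) ^ m.
Proof.
  induction m as [|m IH]; [reflexivity|].
  replace (2 * S m)%nat with (S (S (2 * m))) by lia.
  cbn [ratio]. rewrite IH. unfold quotient.
  assert (E : Nat.even (2 * m) = true) by (rewrite Nat.even_mul; reflexivity).
  assert (O : Nat.even (S (2 * m)) = false)
    by (rewrite Nat.even_succ, <- Nat.negb_even, E; reflexivity).
  rewrite E, O. simpl. ring.
Qed.

Lemma ratio_odd a b m : ratio a b (2 * m + 1) = (a * b) ^ m * a.
Proof.
  replace (2 * m + 1)%nat with (S (2 * m)) by lia.
  cbn [ratio]. rewrite ratio_even. unfold quotient. rewrite Nat.even_mul. reflexivity.
Qed.

Lemma parity k : exists m, k = (2 * m)%nat \/ k = (2 * m + 1)%nat.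
Proof. destruct (Nat.Even_or_Odd k) as [[m H]|[m H]]; exists m; auto. Qed.

Lemma ratio_pos a b k : 0 < a -> 0 < b -> 0 < ratio a b k.
Proof.
  intros Ha Hb; induction k as [|k IH]; simpl; [lra|].
  apply Rmult_lt_0_compat; [exact IH|]. unfold quotient; destruct (Nat.even k); assumption.
Qed.

Lemma ratio_growing a b k j : 1 <= a -> 1 <= b -> (k <= j)%nat -> ratio a b k <= ratio a b j.
Proof.
  intros Ha Hb Hkj; induction Hkj as [|j Hkj IH]; [lra|].
  assert (0 < ratio a b j) by (apply ratio_pos; lra).
  assert (1 <= quotient a b j) by (unfold quotient; destruct (Nat.even j); assumption).
  simpl; nra.
Qed.

(** The two lemmas below express the symmetries of a sequence of quotients of period two:
    a shift by an even number of places rescales the variable by a power of [ab], and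
    reading the sequence backwards exchanges [a] and [b]. *)
Lemma ratio_shift a b m k : ratio a b (2 * m + k) = (a * b) ^ m * ratio a b k.
Proof.
  destruct (parity k) as [i [-> | ->]].
  - replace (2 * m + 2 * i)%nat with (2 * (m + i))%nat by lia.
    rewrite !ratio_even, pow_add; ring.
  - replace (2 * m + (2 * i + 1))%nat with (2 * (m + i) + 1)%nat by lia.
    rewrite !ratio_odd, pow_add; ring.
Qed.

Lemma ratio_reverse a b m k : (k <= 2 * m)%nat ->
  ratio a b (2 * m - k) * ratio b a k = (a * b) ^ m.
Proof.
  intros Hk. destruct (parity k) as [i [-> | ->]].
  - replace (2 * m - 2 * i)%nat with (2 * (m - i))%nat by lia.
    rewrite !ratio_even, (Rmult_comm b a), <- pow_add; f_equal; lia.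
  - replace (2 * m - (2 * i + 1))%nat with (2 * (m - i - 1) + 1)%nat by lia.
    rewrite !ratio_odd, (Rmult_comm b a).
    replace m with ((m - i - 1) + i + 1)%nat at 2 by lia.
    rewrite !pow_add; ring.
Qed.

Lemma ratio_le a b a' b' k : 0 < a' -> 0 < b' -> a' <= a -> a' * b' <= a * b ->
  ratio a' b' k <= ratio a b k.
Proof.
  intros Ha' Hb' Ha Hab.
  assert (0 < a' * b') by nra.
  destruct (parity k) as [i [-> | ->]].
  - rewrite !ratio_even. apply pow_incr; lra.
  - rewrite !ratio_odd. apply Rmult_le_compat; try lra.
    + apply pow_le; lra.
    + apply pow_incr; lra.
Qed.

Lemma coef_pos a b k : 0 < a -> 0 < b -> 0 < coef a b k.
Proof.
  intros Ha Hb; induction k as [|k IH]; simpl; [lra|].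
  apply Rdiv_lt_0_compat; [exact IH | apply ratio_pos; assumption].
Qed.

(** * Terms of the alternating series *)

Lemma term_pos a b x k : 0 < a -> 0 < b -> 0 < x -> 0 < term a b x k.
Proof.
  intros; apply Rmult_lt_0_compat; [apply coef_pos | apply pow_lt]; assumption.
Qed.

Lemma term_succ a b x k : 0 < a -> 0 < b ->
  term a b x (S k) = term a b x k * (x / ratio a b k).
Proof.
  intros Ha Hb; unfold term; simpl. field. apply Rgt_not_eq, ratio_pos; assumption.
Qed.

Lemma term_incr a b x k : 0 < a -> 0 < b -> 0 < x ->
  ratio a b k <= x -> term a b x k <= term a b x (S k).
Proof.
  intros Ha Hb Hx H. rewrite term_succ by assumption.
  assert (0 < term a b x k) by (apply term_pos; assumption).
  assert (1 <= x / ratio a b k)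
    by (apply Rle_div_r; [apply ratio_pos; assumption | lra]).
  nra.
Qed.

Lemma term_decr a b x k : 0 < a -> 0 < b -> 0 < x ->
  x <= ratio a b k -> term a b x (S k) <= term a b x k.
Proof.
  intros Ha Hb Hx H. rewrite term_succ by assumption.
  assert (0 < term a b x k) by (apply term_pos; assumption).
  assert (x / ratio a b k <= 1)
    by (apply Rle_div_l; [apply ratio_pos; assumption | lra]).
  nra.
Qed.

(** The terms of index [2i] and [2i + 1] have the quotient [x / (ab)^i], which is less than [1]. *)
Lemma pair_diff_pos a b x i : 1 <= a -> 1 < b -> 0 < x -> x <= a -> (1 <= i)%nat ->
  0 < pair_diff a b x i.
Proof.
  intros Ha Hb Hx Hxa Hi. unfold pair_diff.
  replace (2 * i + 1)%nat with (S (2 * i)) by lia.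
  rewrite term_succ by lra.
  assert (Hlt : x < ratio a b (2 * i)).
  { apply Rlt_le_trans with (ratio a b 2).
    - simpl. unfold quotient; simpl. nra.
    - apply ratio_growing; try lra; lia. }
  assert (0 < term a b x (2 * i)) by (apply term_pos; lra).
  assert (x / ratio a b (2 * i) < 1)
    by (apply Rlt_div_l; [apply ratio_pos; lra | lra]).
  nra.
Qed.

Lemma altsum_growing a b x N M : 1 <= a -> 1 < b -> 0 < x -> x <= a -> (1 <= N)%nat ->
  (N <= M)%nat -> altsum a b x N <= altsum a b x M.
Proof.
  intros Ha Hb Hx Hxa HN HNM; induction HNM as [|M HNM IH]; [lra|].
  unfold altsum in *; simpl.
  assert (0 < pair_diff a b x M) by (apply pair_diff_pos; try assumption; lia). lra.
Qed.

Lemma altsum_incr a b x N : 1 <= a -> 1 < b -> 0 < x -> x <= a -> (1 <= N)%nat ->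
  altsum a b x N < altsum a b x (S N).
Proof.
  intros Ha Hb Hx Hxa HN. unfold altsum; simpl.
  assert (0 < pair_diff a b x N) by (apply pair_diff_pos; assumption). lra.
Qed.

(** * Dependence of the alternating sums on the quotients *)

(** The comparison of two families needs, at index [k], the inequality between the numbers
    [coef k * ratio k], which equal [coef (k - 1) * quotient (k - 1)]. In this second form it
    propagates from [k] to [k + 2], because the quotient is the same at both places. *)
Lemma weighted_coef_le a b a' b' k : 0 < a' -> 0 < b' -> a' <= a -> a' * b' <= a * b ->
  coef a b (S k) * quotient a b (S k) <= coef a' b' (S k) * quotient a' b' (S k) ->
  coef a b (S (S (S k))) * quotient a b (S (S (S k)))
    <= coef a' b' (S (S (S k))) * quotient a' b' (S (S (S k))).
Proof.
  intros Ha' Hb' Ha Hab H.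
  assert (0 < b) by nra.
  assert (Hq : forall p q j, quotient p q (S (S j)) = quotient p q j) by reflexivity.
  rewrite !Hq.
  change (coef a b (S (S (S k))))
    with (coef a b (S k) / ratio a b (S k) / ratio a b (S (S k))).
  change (coef a' b' (S (S (S k))))
    with (coef a' b' (S k) / ratio a' b' (S k) / ratio a' b' (S (S k))).
  unfold Rdiv.
  replace (coef a b (S k) * / ratio a b (S k) * / ratio a b (S (S k)) * quotient a b (S k))
    with (coef a b (S k) * quotient a b (S k) * (/ ratio a b (S k) * / ratio a b (S (S k)))) by ring.
  replace (coef a' b' (S k) * / ratio a' b' (S k) * / ratio a' b' (S (S k)) * quotient a' b' (S k))
    with (coef a' b' (S k) * quotient a' b' (S k) * (/ ratio a' b' (S k) * / ratio a' b' (S (S k)))) by ring.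
  assert (Hinv : forall j, 0 < / ratio a b j <= / ratio a' b' j).
  { intros j; split; [apply Rinv_0_lt_compat, ratio_pos; lra|].
    apply Rinv_le_contravar; [apply ratio_pos; lra | apply ratio_le; lra]. }
  assert (Hpos : 0 <= coef a b (S k) * quotient a b (S k)).
  { apply Rmult_le_pos; [left; apply coef_pos; lra|].
    unfold quotient; destruct (Nat.even (S k)); lra. }
  destruct (Hinv (S k)), (Hinv (S (S k))).
  apply Rmult_le_compat; try assumption.
  - apply Rmult_le_pos; lra.
  - apply Rmult_le_compat; lra.
Qed.

Lemma weight_eq a b k : 0 < a -> 0 < b ->
  coef a b (S k) * ratio a b (S k) = coef a b k * quotient a b k.
Proof. intros; simpl. field. apply Rgt_not_eq, ratio_pos; assumption. Qed.

(** One step of the comparison of two series with current terms [w, w'] and ratios [r, r'].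
    After clearing denominators and using [x <= r' / 2], what remains is
    [2 w r <= w' r + w r'], which follows from [w r <= w' r'] and [w (r - r')^2 >= 0]. *)
Lemma excess_step w w' r r' x :
  0 < w -> 0 < x -> 0 < r' -> r' <= r -> w <= w' -> w * r <= w' * r' -> 2 * x <= r' ->
  w' * (x / r') - w * (x / r) <= w' - w.
Proof.
  intros Hw Hx Hr' Hrr Hww H H2.
  assert (Hr : 0 < r) by lra.
  apply Rmult_le_reg_r with (r * r'); [nra|].
  replace ((w' * (x / r') - w * (x / r)) * (r * r')) with (x * (w' * r - w * r')) by (field; lra).
  assert (0 <= w' * r - w * r') by nra.
  apply Rle_trans with (r' / 2 * (w' * r - w * r')); [apply Rmult_le_compat_r; lra|].
  replace ((w' - w) * (r * r')) with (r' * (w' * r - w * r)) by ring.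
  apply Rle_trans with (r' * ((w' * r - w * r') / 2)); [lra|].
  apply Rmult_le_compat_l; [lra|].
  (* the inequality [2 w r <= w' r + w r'] is multiplied by [r'] *)
  assert (0 <= (w' * r - w * r) - (w * r - w * r')); [|lra].
  apply Rmult_le_reg_r with r'; [lra|].
  rewrite Rmult_0_l.
  assert (w * r * r <= w' * r' * r) by nra.
  assert (0 <= w * (r - r') * (r - r')) by (repeat apply Rmult_le_pos; lra).
  nra.
Qed.

(** Smaller quotients give larger coefficients. The excess of the terms for [(a', b')] over
    those for [(a, b)] decreases along the series once it is nonzero, so the difference of
    the two alternating sums has the sign of its first nonzero contribution. That
    contribution has index [2] when the first quotient decreases and the second one does
    not, and index [3] when only the second one decreases. *)
Section Comparison.
Variables (a b a' b' x : R).
Hypotheses (Ha' : 1 < a') (Hb' : 1 < b') (Ha : a' <= a) (Hab : a' * b' <= a * b)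
  (Hx : 0 < x) (Hx2 : 2 * x <= a' * b').

Let excess k := term a' b' x k - term a b x k.

Lemma coef_compare k : coef a b k <= coef a' b' k.
Proof.
  assert (0 < b) by nra.
  induction k as [|k IH]; simpl; [lra|].
  apply Rmult_le_compat; try assumption.
  - left; apply coef_pos; lra.
  - left; apply Rinv_0_lt_compat, ratio_pos; lra.
  - apply Rinv_le_contravar; [apply ratio_pos; lra | apply ratio_le; lra].
Qed.

Lemma excess_nonneg k : 0 <= excess k.
Proof.
  unfold excess, term. pose proof (coef_compare k). pose proof (pow_lt x k Hx). nra.
Qed.

Lemma excess_decr_of_weight k : (2 <= k)%nat ->
  coef a b k * ratio a b k <= coef a' b' k * ratio a' b' k ->
  excess (S k) <= excess k.
Proof.
  intros Hk H. assert (0 < b) by nra.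
  unfold excess. rewrite !term_succ by lra.
  apply excess_step; try (apply term_pos; lra); try lra.
  - apply ratio_pos; lra.
  - apply ratio_le; lra.
  - pose proof (excess_nonneg k); unfold excess in *; lra.
  - unfold term. pose proof (pow_lt x k Hx). nra.
  - apply Rle_trans with (ratio a' b' 2).
    + simpl; unfold quotient; simpl; lra.
    + apply ratio_growing; lra || lia.
Qed.

Lemma excess_decr_odd m : (1 <= m)%nat -> excess (2 * m + 2) <= excess (2 * m + 1).
Proof.
  intros Hm. assert (Hb : 0 < b) by nra.
  replace (2 * m + 2)%nat with (S (2 * m + 1)) by lia.
  apply excess_decr_of_weight; [lia|].
  replace (2 * m + 1)%nat with (S (2 * m)) by lia.
  rewrite !weight_eq by lra.
  destruct m as [|m]; [lia|]. clear Hm. induction m as [|m IH].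
  - simpl. unfold quotient; simpl. right; field; lra.
  - replace (2 * S (S m))%nat with (S (S (S (2 * m + 1)))) by lia.
    apply weighted_coef_le; try lra.
    replace (S (2 * m + 1)) with (2 * S m)%nat by lia. exact IH.
Qed.

Lemma excess_decr_even m : b <= b' -> (1 <= m)%nat ->
  excess (2 * m + 1) <= excess (2 * m).
Proof.
  intros Hbb Hm. assert (Hb : 0 < b) by nra.
  replace (2 * m + 1)%nat with (S (2 * m)) by lia.
  apply excess_decr_of_weight; [lia|].
  destruct m as [|m]; [lia|]. clear Hm.
  replace (2 * S m)%nat with (S (2 * m + 1)) by lia.
  rewrite !weight_eq by lra.
  induction m as [|m IH].
  - simpl. unfold quotient; simpl. lra.
  - replace (2 * S m + 1)%nat with (S (S (S (2 * m)))) by lia.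
    apply weighted_coef_le; try lra.
    replace (S (2 * m)) with (2 * m + 1)%nat by lia. exact IH.
Qed.

Lemma altsum_excess N : altsum a' b' x N - altsum a b x N =
  Rsum (fun i => excess (2 * i) - excess (2 * i + 1)) N.
Proof.
  unfold altsum. rewrite <- Rsum_minus. apply Rsum_ext; intros i _.
  unfold pair_diff, excess; ring.
Qed.

Lemma excess_0_1 : excess 0 = 0 /\ excess 1 = 0.
Proof. unfold excess, term; simpl; split; field. Qed.

Lemma altsum_le_of_lower_first N : b <= b' -> altsum a b x N <= altsum a' b' x N.
Proof.
  intros Hbb. cut (0 <= altsum a' b' x N - altsum a b x N); [lra|].
  rewrite altsum_excess. apply Rsum_nonneg; intros i _.
  destruct i as [|i].
  - destruct excess_0_1. change (2 * 0)%nat with 0%nat. change (0 + 1)%nat with 1%nat. lra.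
  - pose proof (excess_decr_even (S i) Hbb ltac:(lia)). lra.
Qed.

(** Here the excess vanishes up to index [2], so the differences are grouped as
    [- e_3 + (e_4 - e_5) + ...] with the pairing shifted by one. *)
Lemma altsum_le_of_lower_second N : a' = a -> (1 <= N)%nat -> altsum a' b' x N <= altsum a b x N.
Proof.
  intros Haa HN. cut (altsum a' b' x N - altsum a b x N <= 0); [lra|].
  rewrite altsum_excess.
  assert (E2 : excess 2 = 0).
  { unfold excess, term; simpl; unfold quotient; simpl. subst a. field. lra. }
  assert (H : forall n, Rsum (fun i => excess (2 * i) - excess (2 * i + 1)) (S n)
                        <= - excess (2 * n + 1)).
  { destruct excess_0_1 as [E0 E1].
    induction n as [|n IH].
    - simpl. rewrite E0, E1. lra.
    - cbn [Rsum] in *. pose proof (excess_nonneg (2 * S n + 1)).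
      assert (excess (2 * S n) <= excess (2 * n + 1)); [|lra].
      destruct n as [|n].
      + change (2 * 1)%nat with 2%nat. change (2 * 0 + 1)%nat with 1%nat. lra.
      + replace (2 * S (S n))%nat with (2 * S n + 2)%nat by lia.
        apply excess_decr_odd; lia. }
  destruct N as [|N]; [lia|].
  specialize (H N). pose proof (excess_nonneg (2 * N + 1)). lra.
Qed.

End Comparison.

(** * Points at which all long truncations alternate in sign *)

Lemma term_shift a b x m k : 0 < a -> 0 < b ->
  term a b (x * (a * b) ^ m) (2 * m + k)
  = term a b (x * (a * b) ^ m) (2 * m) * term a b x k.
Proof.
  intros Ha Hb. induction k as [|k IH].
  - rewrite Nat.add_0_r. unfold term at 3; simpl; ring.
  - rewrite Nat.add_succ_r, !term_succ by assumption. rewrite IH, ratio_shift.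
    assert (ratio a b k <> 0) by (apply Rgt_not_eq, ratio_pos; assumption).
    assert ((a * b) ^ m <> 0) by (apply pow_nonzero; nra).
    field; split; assumption.
Qed.

Lemma term_reverse a b x m k : 0 < a -> 0 < b -> 0 < x -> (k <= 2 * m + 1)%nat ->
  term a b ((a * b) ^ m / x) (2 * m + 1 - k)
  = term a b ((a * b) ^ m / x) (2 * m + 1) * term b a x k.
Proof.
  intros Ha Hb Hx. induction k as [|k IH]; intros Hk.
  - rewrite Nat.sub_0_r. unfold term at 3; simpl; ring.
  - rewrite (term_succ b a) by assumption. rewrite <- Rmult_assoc, <- IH by lia.
    replace (2 * m + 1 - k)%nat with (S (2 * m + 1 - S k)) by lia.
    rewrite term_succ by assumption.
    replace (2 * m + 1 - S k)%nat with (2 * m - k)%nat by lia.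
    rewrite <- (ratio_reverse a b m k) by lia.
    assert (ratio b a k <> 0) by (apply Rgt_not_eq, ratio_pos; assumption).
    assert (ratio a b (2 * m - k) <> 0) by (apply Rgt_not_eq, ratio_pos; assumption).
    field; repeat split; lra || assumption.
Qed.

(** Around the index [2m] the terms at [x (ab)^m] are proportional to the terms at [x] of the
    normalised series, which gives a negative sum. The terms before the index [2m] increase,
    and their pairs contribute nonpositive amounts. *)
Lemma altsum_neg_at_odd_node a b x m N : 1 <= a -> 1 <= b -> 1 < x -> negative_sums a b x ->
  (m < N)%nat -> altsum a b (x * (a * b) ^ m) N < 0.
Proof.
  intros Ha Hb Hx Hneg HmN.
  set (y := x * (a * b) ^ m).
  assert (HP : 1 <= (a * b) ^ m) by (apply pow_R1_Rle; nra).
  assert (Hy : 0 < y) by (unfold y; nra).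
  unfold altsum. replace N with (m + (N - m))%nat by lia. rewrite Rsum_split.
  assert (Rsum (pair_diff a b y) m <= 0).
  { apply Rsum_nonpos; intros i Hi. unfold pair_diff.
    assert (term a b y (2 * i) <= term a b y (S (2 * i))).
    { apply term_incr; try lra.
      apply Rle_trans with (ratio a b (2 * m)).
      - apply ratio_growing; lra || lia.
      - rewrite ratio_even. unfold y; nra. }
    replace (2 * i + 1)%nat with (S (2 * i)) by lia. lra. }
  rewrite (Rsum_ext (fun i => pair_diff a b y (m + i))
             (fun i => term a b y (2 * m) * pair_diff a b x i)).
  - rewrite Rsum_scal. change (Rsum (pair_diff a b x) (N - m)) with (altsum a b x (N - m)).
    assert (0 < term a b y (2 * m)) by (apply term_pos; lra).
    assert (altsum a b x (N - m) < 0) by (apply Hneg; lia).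
    nra.
  - intros i _. unfold pair_diff.
    replace (2 * (m + i))%nat with (2 * m + 2 * i)%nat by lia.
    replace (2 * m + 2 * i + 1)%nat with (2 * m + (2 * i + 1))%nat by lia.
    unfold y; rewrite !term_shift by lra. ring.
Qed.

(** The mirror image of the previous lemma: going down from the index [2m + 1], the terms at
    [(ab)^m / x] are proportional to those of the series with [a] and [b] exchanged. The
    terms of higher index decrease, and their pairs contribute nonnegative amounts. *)
Lemma altsum_pos_at_even_node a b x m N : 1 <= a -> 1 <= b -> 1 < x -> negative_sums b a x ->
  (m < N)%nat -> 0 < altsum a b ((a * b) ^ m / x) N.
Proof.
  intros Ha Hb Hx Hneg HmN.
  set (y := (a * b) ^ m / x).
  assert (HP : 1 <= (a * b) ^ m) by (apply pow_R1_Rle; nra).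
  assert (Hy : 0 < y) by (unfold y; apply Rdiv_lt_0_compat; lra).
  assert (HyP : y <= (a * b) ^ m) by (unfold y; apply Rle_div_l; nra).
  unfold altsum. replace N with (S m + (N - S m))%nat by lia. rewrite Rsum_split.
  assert (0 <= Rsum (fun i => pair_diff a b y (S m + i)) (N - S m)).
  { apply Rsum_nonneg; intros i Hi. unfold pair_diff.
    set (j := (S m + i)%nat).
    assert (term a b y (S (2 * j)) <= term a b y (2 * j)).
    { apply term_decr; try lra.
      apply Rle_trans with (ratio a b (2 * m)).
      - rewrite ratio_even. exact HyP.
      - apply ratio_growing; lra || lia. }
    replace (2 * j + 1)%nat with (S (2 * j)) by lia. lra. }
  rewrite Rsum_rev.
  rewrite (Rsum_ext _ (fun i => - term a b y (2 * m + 1) * pair_diff b a x i)).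
  - rewrite Rsum_scal. change (Rsum (pair_diff b a x) (S m)) with (altsum b a x (S m)).
    assert (0 < term a b y (2 * m + 1)) by (apply term_pos; lra).
    assert (altsum b a x (S m) < 0) by (apply Hneg; lia).
    nra.
  - intros i Hi. unfold pair_diff.
    replace (2 * (m - i))%nat with (2 * m + 1 - (2 * i + 1))%nat by lia.
    replace (2 * m + 1 - (2 * i + 1) + 1)%nat with (2 * m + 1 - 2 * i)%nat by lia.
    unfold y; rewrite !term_reverse by (lra || lia). ring.
Qed.

(** * Limits and series *)

Lemma filterlim_Cmod (u : nat -> C) (l : C) :
  filterlim u eventually (locally l) <->
  forall eps, 0 < eps -> exists N, forall n, (N <= n)%nat -> Cmod (u n - l) < eps.
Proof.
  rewrite (filterlim_locally_ball_norm (K := C_AbsRing) (U := C_NormedModule)).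
  split.
  - intros H eps Heps. exact (H (mkposreal eps Heps)).
  - intros H eps. exact (H eps (cond_pos eps)).
Qed.

Lemma Rsum_sum_n f n : Rsum f (S n) = sum_n f n.
Proof.
  induction n as [|n IH].
  - rewrite sum_O; simpl; ring.
  - rewrite sum_Sn, <- IH. reflexivity.
Qed.

Lemma Rsum_le_series B s n : (forall k, 0 <= B k) -> is_series B s -> Rsum B n <= s.
Proof.
  intros HB Hs.
  assert (Hmon : forall i j, Rsum B i <= Rsum B (i + j)).
  { intros i j. rewrite Rsum_split.
    assert (0 <= Rsum (fun k => B (i + k)%nat) j) by (apply Rsum_nonneg; auto). lra. }
  change (Rbar_le (Rsum B n) s).
  apply (is_lim_seq_le_loc (fun _ => Rsum B n) (sum_n B) (Rsum B n) s).
  - exists n. intros m Hm. rewrite <- Rsum_sum_n.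
    replace (S m) with (n + (S m - n))%nat by lia. apply Hmon.
  - apply is_lim_seq_const.
  - exact Hs.
Qed.

Lemma series_tail B s eps : (forall k, 0 <= B k) -> is_series B s -> 0 < eps ->
  exists K, forall k n, (K <= k)%nat -> Rsum B n - Rsum B k < eps.
Proof.
  intros HB Hs Heps.
  assert (H : is_lim_seq (sum_n B) s) by exact Hs.
  apply is_lim_seq_spec in H. destruct (H (mkposreal eps Heps)) as [K HK].
  exists (S K). intros k n Hk.
  pose proof (Rsum_le_series B s n HB Hs).
  destruct k as [|k]; [lia|]. specialize (HK k ltac:(lia)). simpl in HK.
  rewrite <- Rsum_sum_n in HK. apply Rabs_def2 in HK. lra.
Qed.

(** * Cluster points of bounded families of sequences *)

(** Weaker than the convergence of a subsequence, and all that the passage to the limit in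
    an infinite product requires. *)
Definition clusters (t : nat -> nat -> R) (K : nat) (tau : nat -> R) : Prop :=
  forall delta n0, 0 < delta ->
  exists n, (n0 <= n)%nat /\ forall k, (k < K)%nat -> Rabs (t n k - tau k) < delta.

(** Choose indices along which the first [K] coordinates converge and apply the
    Bolzano-Weierstrass theorem to the next coordinate. *)
Lemma clusters_extend t B K tau : (forall n, 0 <= t n K <= B) -> clusters t K tau ->
  exists s, clusters t (S K) (fun k => if Nat.ltb k K then tau k else s).
Proof.
  intros Ht Hc.
  assert (Hphi : forall i, {n | (i <= n)%nat /\
            forall k, (k < K)%nat -> Rabs (t n k - tau k) < / INR (S i)}).
  { intros i. apply constructive_indefinite_description, Hc.
    apply Rinv_0_lt_compat, lt_0_INR; lia. }
  set (phi := fun i => proj1_sig (Hphi i)).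
  assert (Hphi' : forall i, (i <= phi i)%nat /\
            forall k, (k < K)%nat -> Rabs (t (phi i) k - tau k) < / INR (S i))
    by (intros i; exact (proj2_sig (Hphi i))).
  destruct (Bolzano_Weierstrass (fun i => t (phi i) K) (fun c => 0 <= c <= B))
    as [s Hs].
  { apply compact_P3. }
  { intros i; apply Ht. }
  exists s. intros delta n0 Hdelta.
  destruct (archimed_cor1 delta Hdelta) as [j [Hj Hj0]].
  destruct (Hs (disc s (mkposreal delta Hdelta)) (Nat.max n0 j)) as [p [Hp Hps]].
  { exists (mkposreal delta Hdelta). intros y Hy; exact Hy. }
  destruct (Hphi' p) as [H1 H2].
  exists (phi p). split; [lia|]. intros k Hk.
  destruct (Nat.ltb_spec k K) as [Hlt|Hge].
  - apply Rlt_trans with (/ INR (S p)); [apply H2; exact Hlt|].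
    apply Rle_lt_trans with (/ INR j); [|exact Hj].
    apply Rinv_le_contravar; [apply lt_0_INR; lia | apply le_INR; lia].
  - replace k with K by lia. exact Hps.
Qed.

(** Iterating the extension step never changes the coordinates already chosen, so the
    coordinates fixed at the successive stages form a single sequence. *)
Lemma cluster_point t B : (forall n k, 0 <= t n k <= B k) ->
  exists tau, forall K, clusters t K tau.
Proof.
  intros Ht.
  set (next := fun K tau => epsilon (inhabits 0)
     (fun s => clusters t (S K) (fun k => if Nat.ltb k K then tau k else s))).
  set (stage := fix stage K : nat -> R := match K with
     | O => fun _ => 0
     | S J => fun k => if Nat.ltb k J then stage J k else next J (stage J) end).
  assert (Hstage : forall K, clusters t K (stage K)).
  { induction K as [|K IH].
    - intros delta n0 _. exists n0. split; [lia|]. intros k Hk; lia.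
    - simpl. unfold next. apply epsilon_spec.
      apply (clusters_extend t (B K)); [intros n; apply Ht | exact IH]. }
  assert (Hstable : forall K k, (k < K)%nat -> stage K k = stage (S k) k).
  { induction K as [|K IH]; intros k Hk; [lia|].
    destruct (Nat.eq_dec k K) as [->|Hne]; [reflexivity|].
    rewrite <- IH by lia. simpl.
    destruct (Nat.ltb_spec k K); [reflexivity | lia]. }
  exists (fun k => stage (S k) k). intros K delta n0 Hdelta.
  destruct (Hstage K delta n0 Hdelta) as [n [Hn Hk]].
  exists n. split; [exact Hn|]. intros k Hlt.
  rewrite <- (Hstable K k Hlt). apply Hk, Hlt.
Qed.

Lemma cluster_bounds t tau k lo hi n0 : clusters t (S k) tau ->
  (forall n, (n0 <= n)%nat -> lo <= t n k <= hi) -> lo <= tau k <= hi.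
Proof.
  intros Hc Ht. split; apply Rnot_lt_le; intros Hlt.
  - destruct (Hc (lo - tau k) n0 ltac:(lra)) as [n [Hn H]].
    specialize (H k ltac:(lia)). specialize (Ht n Hn).
    apply Rabs_def2 in H. lra.
  - destruct (Hc (tau k - hi) n0 ltac:(lra)) as [n [Hn H]].
    specialize (H k ltac:(lia)). specialize (Ht n Hn).
    apply Rabs_def2 in H. lra.
Qed.

(** * Products of linear factors *)

(** The parameter is the inverse of a zero: this makes a missing zero the value [0], and
    makes the factors depend continuously on the parameter. *)
Definition linear_factor (t : nat -> R) (z : C) (k : nat) : C := (1 + z * RtoC (t k))%C.

Lemma Cprod_ext F G n : (forall k, (k < n)%nat -> F k = G k) -> Cprod F n = Cprod G n.
Proof.
  induction n as [|n IH]; intros H; simpl; [reflexivity|].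
  rewrite IH, H by auto; reflexivity.
Qed.

Lemma Cmod_linear_factor t z k b : 0 <= t k <= b ->
  Cmod (linear_factor t z k) <= exp (Cmod z * b).
Proof.
  intros Ht. unfold linear_factor.
  pose proof (Cmod_ge_0 z).
  apply Rle_trans with (1 + Cmod z * b).
  - eapply Rle_trans; [apply Cmod_triangle|].
    rewrite Cmod_1, Cmod_mult, Cmod_R, Rabs_pos_eq by lra. nra.
  - pose proof (exp_ineq1_le (Cmod z * b)). lra.
Qed.

Lemma Cmod_prod_le t B z n : (forall k, 0 <= t k <= B k) ->
  Cmod (Cprod (linear_factor t z) n) <= exp (Cmod z * Rsum B n).
Proof.
  intros Ht. induction n as [|n IH]; simpl.
  - rewrite Cmod_1, Rmult_0_r, exp_0. lra.
  - rewrite Cmod_mult, Rmult_plus_distr_l, exp_plus.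
    apply Rmult_le_compat; try apply Cmod_ge_0; try assumption.
    apply Cmod_linear_factor, Ht.
Qed.

Lemma Cmod_prod_diff_le s t B z n :
  (forall k, 0 <= s k <= B k) -> (forall k, 0 <= t k <= B k) ->
  Cmod (Cprod (linear_factor s z) n - Cprod (linear_factor t z) n)
  <= exp (Cmod z * Rsum B n) * (Cmod z * Rsum (fun k => Rabs (s k - t k)) n).
Proof.
  intros Hs Ht. induction n as [|n IH]; simpl.
  - replace (RtoC 1 - RtoC 1)%C with (RtoC 0) by ring. rewrite Cmod_0. lra.
  - set (p := Cprod (linear_factor s z) n) in *.
    set (q := Cprod (linear_factor t z) n) in *.
    replace (p * linear_factor s z n - q * linear_factor t z n)%C
      with ((p - q) * linear_factor s z n + q * (z * RtoC (s n - t n)))%C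
      by (unfold linear_factor; rewrite RtoC_minus; ring).
    eapply Rle_trans; [apply Cmod_triangle|].
    rewrite !Cmod_mult, Cmod_R, Rmult_plus_distr_l, exp_plus.
    pose proof (Cmod_linear_factor s z n (B n) (Hs n)) as H1.
    pose proof (Cmod_prod_le t B z n Ht) as H2. fold q in H2.
    set (E := exp (Cmod z * Rsum B n)) in *.
    set (e := exp (Cmod z * B n)) in *.
    set (T := Rsum (fun k => Rabs (s k - t k)) n) in *.
    assert (He : 1 <= e).
    { unfold e. specialize (Hs n). pose proof (Cmod_ge_0 z).
      pose proof (exp_ineq1_le (Cmod z * B n)). nra. }
    assert (HE : 0 < E) by apply exp_pos.
    pose proof (Cmod_ge_0 z). pose proof (Rabs_pos (s n - t n)).
    set (d := Rabs (s n - t n)) in *.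
    assert (A1 : Cmod (p - q) * Cmod (linear_factor s z n) <= E * (Cmod z * T) * e)
      by (apply Rmult_le_compat; try apply Cmod_ge_0; assumption).
    assert (A2 : Cmod q * (Cmod z * d) <= E * (Cmod z * d))
      by (apply Rmult_le_compat_r; [nra | assumption]).
    assert (A3 : E * (Cmod z * d) <= E * (Cmod z * d) * e).
    { assert (0 <= E * (Cmod z * d)) by (apply Rmult_le_pos; nra). nra. }
    apply Rle_trans with (E * (Cmod z * T) * e + E * (Cmod z * d) * e); [lra|].
    right; ring.
Qed.

(** Setting the parameters to [0] from [K] on makes products of different lengths
    comparable factor by factor. *)
Lemma Cprod_truncate t z K n : (K <= n)%nat ->
  Cprod (linear_factor (fun k => if Nat.ltb k K then t k else 0) z) n
  = Cprod (linear_factor t z) K.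
Proof.
  intros HK. induction HK as [|n HK IH].
  - apply Cprod_ext; intros k Hk. unfold linear_factor.
    destruct (Nat.ltb_spec k K); [reflexivity | lia].
  - simpl. rewrite IH. unfold linear_factor at 2.
    destruct (Nat.ltb_spec n K); [lia | ring].
Qed.

(** The summable majorant [B] makes the tails of all the products uniformly negligible.
    Hence it suffices that finitely many parameters are close to those of [tau] for some
    large [n], which is what clustering provides. *)
Lemma product_of_cluster (t : nat -> nat -> R) (B tau : nat -> R) (d : nat -> nat) z l :
  (forall n k, 0 <= t n k <= B k) -> ex_series B -> (forall n, (n <= d n)%nat) ->
  (forall K, clusters t K tau) ->
  filterlim (fun n => Cprod (linear_factor (t n) z) (d n)) eventually (locally l) ->
  filterlim (Cprod (linear_factor tau z)) eventually (locally l).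
Proof.
  intros Ht [s Hs] Hd Hc Hl.
  assert (HB : forall k, 0 <= B k) by (intros k; specialize (Ht O k); lra).
  assert (Htau : forall k, 0 <= tau k <= B k).
  { intros k. apply (cluster_bounds t tau k 0 (B k) 0 (Hc (S k))). intros n _; apply Ht. }
  rewrite filterlim_Cmod in Hl |- *. intros eps Heps.
  (* [A] bounds the Lipschitz constant of every partial product in the l^1 distance of the
     parameters *)
  set (A := exp (Cmod z * s) * (Cmod z + 1)).
  pose proof (Cmod_ge_0 z) as Hz.
  assert (HA : 0 < A) by (apply Rmult_lt_0_compat; [apply exp_pos | lra]).
  set (eta := eps / (4 * A)).
  assert (Heta : 0 < eta) by (apply Rdiv_lt_0_compat; lra).
  destruct (series_tail B s eta HB Hs Heta) as [K0 HK0].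
  destruct (Hl (eps / 2) ltac:(lra)) as [n1 Hn1].
  exists K0. intros K HK.
  assert (HK1 : 0 < INR (S K)) by (apply lt_0_INR; lia).
  destruct (Hc K (eta / INR (S K)) (Nat.max n1 K)) as [n [Hn Hclose]].
  { apply Rdiv_lt_0_compat; assumption. }
  specialize (Hn1 n ltac:(lia)).
  set (tau' := fun k => if Nat.ltb k K then tau k else 0).
  assert (Htau' : forall k, 0 <= tau' k <= B k).
  { intros k. unfold tau'. specialize (HB k). specialize (Htau k).
    destruct (Nat.ltb k K); lra. }
  rewrite <- (Cprod_truncate tau z K (d n)) by (specialize (Hd n); lia).
  fold tau'.
  assert (Hdist : Rsum (fun k => Rabs (tau' k - t n k)) (d n) <= 2 * eta).
  { replace (d n) with (K + (d n - K))%nat by (specialize (Hd n); lia).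
    rewrite Rsum_split.
    apply Rle_trans with (Rsum (fun _ => eta / INR (S K) * 1) K
                          + Rsum (fun k => B (K + k)%nat) (d n - K)).
    - apply Rplus_le_compat; apply Rsum_le; intros k Hk; unfold tau'.
      + destruct (Nat.ltb_spec k K); [|lia].
        rewrite Rabs_minus_sym, Rmult_1_r. left; apply Hclose; assumption.
      + destruct (Nat.ltb_spec (K + k) K); [lia|].
        specialize (Ht n (K + k)%nat).
        rewrite Rminus_0_l, Rabs_Ropp, Rabs_pos_eq; lra.
    - rewrite Rsum_scal.
      assert (E1 : Rsum (fun _ => 1) K = INR K).
      { clear. induction K as [|K IH]; [reflexivity|]. rewrite S_INR. simpl Rsum. lra. }
      rewrite E1.
      assert (eta / INR (S K) * INR K <= eta).
      { replace (eta / INR (S K) * INR K) with (eta * (INR K / INR (S K))) by (field; lra).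
        assert (INR K / INR (S K) <= 1); [|nra].
        apply Rle_div_l; [assumption|]. rewrite S_INR; lra. }
      specialize (HK0 K (K + (d n - K))%nat HK). rewrite Rsum_split in HK0. lra. }
  replace (Cprod (linear_factor tau' z) (d n) - l)%C
    with ((Cprod (linear_factor tau' z) (d n) - Cprod (linear_factor (t n) z) (d n))
          + (Cprod (linear_factor (t n) z) (d n) - l))%C by ring.
  eapply Rle_lt_trans; [apply Cmod_triangle|].
  cut (Cmod (Cprod (linear_factor tau' z) (d n) - Cprod (linear_factor (t n) z) (d n))
       <= eps / 2); [lra|].
  eapply Rle_trans; [apply (Cmod_prod_diff_le tau' (t n) B z (d n) Htau' (Ht n))|].
  set (D := Rsum (fun k => Rabs (tau' k - t n k)) (d n)) in *.
  assert (HD : 0 <= D) by (apply Rsum_nonneg; intros; apply Rabs_pos).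
  apply Rle_trans with (exp (Cmod z * s) * ((Cmod z + 1) * (2 * eta))).
  - apply Rmult_le_compat.
    + left; apply exp_pos.
    + nra.
    + pose proof (Rsum_le_series B s (d n) HB Hs).
      destruct (Rle_lt_or_eq_dec (Cmod z * Rsum B (d n)) (Cmod z * s)) as [H1|H1].
      * apply Rmult_le_compat_l; assumption.
      * left; apply exp_increasing; exact H1.
      * rewrite H1; lra.
    + apply Rmult_le_compat; lra.
  - rewrite <- Rmult_assoc. fold A. unfold eta. right; field; lra.
Qed.

(** * Polynomials with prescribed real roots *)

Definition Reval (l : list R) (x : R) : R := fold_right (fun c r => c + x * r) 0 l.
Definition Ceval (l : list R) (z : C) : C :=
  fold_right (fun c r => RtoC c + z * r)%C (RtoC 0) l.

(** One and the same real quotient serves for real and for complex arguments, so that roots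
    found on the real line factor the polynomial over the complex plane. *)
Lemma divide_root (l : list R) (w : R) : exists l',
  length l' = pred (length l) /\
  (forall x, Reval l x = Reval l' x * (x - w) + Reval l w) /\
  (forall z, Ceval l z = (Ceval l' z * (z - RtoC w) + RtoC (Reval l w))%C).
Proof.
  induction l as [|c l [l' [Hlen [HR HC]]]].
  - exists nil. repeat split; intros; simpl; ring.
  - destruct l as [|c' l].
    + exists nil. repeat split; intros; simpl; [ring|].
      rewrite Rmult_0_r, Rplus_0_r. ring.
    + exists (Reval (c' :: l) w :: l'). repeat split.
      * simpl in *. rewrite Hlen. reflexivity.
      * intros x. change (Reval (c :: c' :: l) x) with (c + x * Reval (c' :: l) x).
        change (Reval (c :: c' :: l) w) with (c + w * Reval (c' :: l) w).
        rewrite (HR x). cbn [Reval fold_right].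
        change (fold_right _ 0 l') with (Reval l' x). ring.
      * intros z. change (Ceval (c :: c' :: l) z) with (RtoC c + z * Ceval (c' :: l) z)%C.
        change (Reval (c :: c' :: l) w) with (c + w * Reval (c' :: l) w).
        rewrite (HC z). rewrite RtoC_plus, RtoC_mult.
        set (r := Reval (c' :: l) w).
        change (Ceval (r :: l') z) with (RtoC r + z * Ceval l' z)%C. ring.
Qed.

Lemma factor_from_roots n : forall (l : list R) (t : nat -> R),
  length l = S n ->
  (forall k, (k < n)%nat -> t k <> 0 /\ Reval l (- / t k) = 0) ->
  (forall j k, (j < k)%nat -> (k < n)%nat -> t j <> t k) ->
  exists c, forall z, Ceval l z = (RtoC c * Cprod (linear_factor t z) n)%C.
Proof.
  induction n as [|n IH]; intros l t Hlen Hroot Hdist.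
  - destruct l as [|c [|c' l]]; try discriminate. exists c. intros z; simpl; ring.
  - destruct (divide_root l (- / t n)) as [l' [Hlen' [HR HC]]].
    destruct (Hroot n ltac:(lia)) as [Htn Hrn].
    destruct (IH l' t) as [c Hc].
    + rewrite Hlen', Hlen; reflexivity.
    + intros k Hk. destruct (Hroot k ltac:(lia)) as [Htk Hrk]. split; [exact Htk|].
      rewrite HR, Hrn, Rplus_0_r in Hrk.
      apply Rmult_integral in Hrk. destruct Hrk as [Hrk|Hrk]; [exact Hrk|exfalso].
      apply (Hdist k n Hk); [lia|].
      assert (E : / t k = / t n) by lra.
      rewrite <- (Rinv_inv (t k)), E, Rinv_inv. reflexivity.
    + intros j k Hj Hk. apply Hdist; lia.
    + exists (c * / t n). intros z. rewrite HC, Hrn, Hc. simpl.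
      unfold linear_factor at 3. rewrite RtoC_mult, RtoC_opp, RtoC_inv by assumption.
      field. intros E; apply Htn. apply RtoC_inj in E. exact E.
Qed.

Lemma Reval_app l c x : Reval (l ++ c :: nil) x = Reval l x + c * x ^ length l.
Proof.
  induction l as [|d l IH]; [simpl; ring|].
  change (Reval ((d :: l) ++ c :: nil) x) with (d + x * Reval (l ++ c :: nil) x).
  change (Reval (d :: l) x) with (d + x * Reval l x).
  rewrite IH; simpl; ring.
Qed.

Lemma Ceval_app l c z : Ceval (l ++ c :: nil) z = (Ceval l z + RtoC c * z ^ length l)%C.
Proof.
  induction l as [|d l IH]; [simpl; ring|].
  change (Ceval ((d :: l) ++ c :: nil) z) with (RtoC d + z * Ceval (l ++ c :: nil) z)%C.
  change (Ceval (d :: l) z) with (RtoC d + z * Ceval l z)%C.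
  rewrite IH; simpl; ring.
Qed.

Definition truncation (u : nat -> R) (n : nat) : list R := map u (seq 0 n).

Lemma truncation_S u n : truncation u (S n) = truncation u n ++ u n :: nil.
Proof. unfold truncation. rewrite seq_S, map_app. reflexivity. Qed.

Lemma truncation_length u n : length (truncation u n) = n.
Proof. unfold truncation. rewrite length_map, length_seq. reflexivity. Qed.

Lemma Reval_truncation u n x : Reval (truncation u n) x = Rsum (fun k => u k * x ^ k) n.
Proof.
  induction n as [|n IH]; [reflexivity|].
  rewrite truncation_S, Reval_app, truncation_length, IH. reflexivity.
Qed.

Lemma Ceval_truncation u n z :
  Ceval (truncation u (S n)) z = sum_n (fun k => RtoC (u k) * Cpow z k)%C n.
Proof.
  induction n as [|n IH].
  - rewrite sum_O. simpl. ring.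
  - rewrite truncation_S, Ceval_app, truncation_length, IH, sum_Sn. reflexivity.
Qed.

Lemma altsum_polynomial a b x N :
  altsum a b x N = Reval (truncation (coef a b) (2 * N)) (- x).
Proof.
  rewrite Reval_truncation. unfold altsum. induction N as [|N IH]; [reflexivity|].
  replace (2 * S N)%nat with (S (S (2 * N))) by lia.
  cbn [Rsum]. rewrite IH. unfold pair_diff, term.
  replace (2 * N + 1)%nat with (S (2 * N)) by lia.
  replace ((- x) ^ (2 * N)) with (x ^ (2 * N))
    by (rewrite !pow_mult; f_equal; ring).
  replace ((- x) ^ S (2 * N)) with (- x ^ S (2 * N))
    by (rewrite <- !tech_pow_Rmult, !pow_mult;
        replace ((- x) ^ 2) with (x ^ 2) by ring; ring).
  ring.
Qed.

Lemma Reval_continuous l : continuity (Reval l).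
Proof.
  induction l as [|c l IH].
  - apply continuity_const. intros ? ?; reflexivity.
  - apply (continuity_plus (fun _ => c) (fun x => x * Reval l x)).
    + apply continuity_const. intros ? ?; reflexivity.
    + apply (continuity_mult id (Reval l)); [|exact IH].
      apply derivable_continuous, derivable_id.
Qed.

(** The sign pattern comes from scaled copies of the point [x] ([k] odd) and of [1 / x]
    ([k] even). They interlace as [1/x < x < ab/x < x ab < ...], since [1 < x^2 < ab]. *)
Definition node (a b x : R) (k : nat) : R :=
  if Nat.even k then (a * b) ^ Nat.div2 k / x else x * (a * b) ^ Nat.div2 k.

Lemma node_even a b x m : node a b x (2 * m) = (a * b) ^ m / x.
Proof. unfold node. rewrite Nat.even_mul, Nat.div2_double. reflexivity. Qed.

Lemma node_odd a b x m : node a b x (2 * m + 1) = x * (a * b) ^ m.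
Proof.
  unfold node. rewrite Nat.add_1_r, Nat.div2_succ_double, Nat.even_succ.
  rewrite <- Nat.negb_even, Nat.even_mul. reflexivity.
Qed.

Section Sufficiency.
Variables a b x : R.
Hypotheses (Ha : 1 <= a) (Hb : 1 <= b) (Hx : 1 < x) (Hxab : x * x < a * b)
  (Hneg : negative_sums a b x) (Hneg' : negative_sums b a x).

Let y := node a b x.

Lemma node_pos k : 0 < y k.
Proof.
  assert (HP : forall m, 0 < (a * b) ^ m) by (intros m; apply pow_lt; nra).
  destruct (parity k) as [m [-> | ->]]; unfold y.
  - rewrite node_even. apply Rdiv_lt_0_compat; [apply HP | lra].
  - rewrite node_odd. apply Rmult_lt_0_compat; [lra | apply HP].
Qed.

Lemma node_lt_succ k : y k < y (S k).
Proof.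
  assert (HP : forall m, 0 < (a * b) ^ m) by (intros m; apply pow_lt; nra).
  destruct (parity k) as [m [-> | ->]]; unfold y; specialize (HP m).
  - replace (S (2 * m)) with (2 * m + 1)%nat by lia.
    rewrite node_even, node_odd.
    apply Rlt_div_l; [lra|].
    assert (1 < x * x) by nra. nra.
  - replace (S (2 * m + 1)) with (2 * S m)%nat by lia.
    rewrite node_even, node_odd. apply (Rlt_div_r _ _ x); [lra|].
    pose proof (Rmult_lt_compat_r _ _ _ HP Hxab). rewrite <- tech_pow_Rmult. lra.
Qed.

Lemma node_le j k : (j <= k)%nat -> y j <= y k.
Proof.
  intros H; induction H as [|k H IH]; [lra|]. pose proof (node_lt_succ k). lra.
Qed.

Lemma alternation k N : (S k < 2 * N)%nat -> altsum a b (y k) N * altsum a b (y (S k)) N < 0.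
Proof.
  intros HkN. destruct (parity k) as [m [-> | ->]]; unfold y.
  - replace (S (2 * m)) with (2 * m + 1)%nat by lia.
    rewrite node_even, node_odd.
    pose proof (altsum_pos_at_even_node a b x m N Ha Hb Hx Hneg' ltac:(lia)).
    pose proof (altsum_neg_at_odd_node a b x m N Ha Hb Hx Hneg ltac:(lia)). nra.
  - replace (S (2 * m + 1)) with (2 * S m)%nat by lia. rewrite node_even, node_odd.
    pose proof (altsum_pos_at_even_node a b x (S m) N Ha Hb Hx Hneg' ltac:(lia)).
    pose proof (altsum_neg_at_odd_node a b x m N Ha Hb Hx Hneg ltac:(lia)). nra.
Qed.

Lemma root_between k N : (S k < 2 * N)%nat ->
  exists r, y k < r < y (S k) /\ altsum a b r N = 0.
Proof.
  intros HkN. pose proof (alternation k N HkN) as Hsign.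
  assert (Hcont : continuity (fun r => altsum a b r N)).
  { intros r. apply (continuity_pt_ext
      (fun r => comp (Reval (truncation (coef a b) (2 * N))) Ropp r)).
    - intros r'. unfold comp. symmetry. apply altsum_polynomial.
    - apply continuity_pt_comp; [|apply Reval_continuous].
      apply (continuity_pt_opp id), derivable_continuous_pt, derivable_pt_id. }
  pose proof (node_lt_succ k).
  destruct (IVT_cor _ (y k) (y (S k)) Hcont) as [r [[Hl Hr] H0]]; [lra | lra |].
  exists r. split; [|exact H0].
  split.
  - destruct Hl as [Hl|Hl]; [exact Hl|]. subst r. rewrite H0 in Hsign. lra.
  - destruct Hr as [Hr|Hr]; [exact Hr|]. rewrite <- Hr, H0 in Hsign. lra.
Qed.

(** The polynomial has degree [2n + 1], so its roots have indices below [2n + 1]; the value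
    [0] stands for the missing ones. *)
Lemma inverse_root_exists n k : exists t,
  (if Nat.ltb k (2 * n + 1)
   then / y (S k) < t < / y k /\ altsum a b (/ t) (S n) = 0 else t = 0).
Proof.
  destruct (Nat.ltb_spec k (2 * n + 1)) as [Hk|Hk]; [|exists 0; reflexivity].
  destruct (root_between k (S n) ltac:(lia)) as [r [[H1 H2] H0]].
  pose proof (node_pos k).
  exists (/ r). rewrite Rinv_inv. repeat split; [| |exact H0];
    apply Rinv_lt_contravar; try assumption; apply Rmult_lt_0_compat; lra.
Qed.

(** Geometric, hence summable, and independent of the degree of the polynomials. *)
Definition root_bound k := x * sqrt (a * b) * (/ sqrt (a * b)) ^ k.

Lemma inverse_node_le_root_bound k : / y k <= root_bound k.
Proof.
  unfold root_bound. set (s := sqrt (a * b)).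
  assert (Hs2 : s * s = a * b) by (apply sqrt_sqrt; nra).
  assert (Hs : 1 <= s) by (apply Rsqr_incr_0_var; unfold Rsqr; [nra | apply sqrt_pos]).
  assert (HP : forall m, 0 < (a * b) ^ m) by (intros m; apply pow_lt; nra).
  assert (Hpow : forall m, (/ s) ^ (2 * m) = / (a * b) ^ m).
  { intros m. rewrite pow_inv, pow_mult. f_equal. f_equal. rewrite <- Hs2; ring. }
  assert (Hi : forall m, 0 < / (a * b) ^ m) by (intros m; apply Rinv_0_lt_compat, HP).
  destruct (parity k) as [m [-> | ->]]; unfold y; specialize (HP m); specialize (Hi m).
  - rewrite node_even, Hpow, Rinv_div.
    unfold Rdiv. apply Rmult_le_compat_r; [lra | nra].
  - rewrite node_odd, pow_add, Hpow, Rinv_mult, pow_1.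
    replace (x * s * (/ (a * b) ^ m * / s)) with (x * / (a * b) ^ m) by (field; lra).
    apply Rmult_le_compat_r; [lra|].
    assert (/ x < / 1) by (apply Rinv_lt_contravar; lra). rewrite Rinv_1 in *. lra.
Qed.

Lemma root_bound_summable : ex_series root_bound.
Proof.
  apply (ex_series_scal_l (x * sqrt (a * b)) (fun k => (/ sqrt (a * b)) ^ k)).
  apply ex_series_geom.
  assert (Hs : 1 < sqrt (a * b)).
  { rewrite <- sqrt_1. apply sqrt_lt_1_alt. nra. }
  rewrite Rabs_pos_eq by (left; apply Rinv_0_lt_compat; lra).
  rewrite <- Rinv_1. apply Rinv_lt_contravar; lra.
Qed.

(** The truncation of degree [2n + 1] alternates in sign at [2n + 2] nodes, so all its roots
    are real and it is the product of its linear factors. The inverse roots lie between the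
    inverses of fixed nodes, uniformly in [n], and a cluster point of them gives the product
    for the limit function; the lower bounds keep the limits positive. *)
Lemma product_of_negative_sums (F : C -> C) : is_entire_series (coef a b) F ->
  exists t, (forall k, 0 < t k) /\ ex_series t /\
    forall z, filterlim (Cprod (linear_factor t z)) eventually (locally (F z)).
Proof.
  intros HF.
  set (t := fun n k => epsilon (inhabits 0) (fun r =>
    if Nat.ltb k (2 * n + 1)
    then / y (S k) < r < / y k /\ altsum a b (/ r) (S n) = 0 else r = 0)).
  assert (Ht : forall n k, if Nat.ltb k (2 * n + 1)
   then / y (S k) < t n k < / y k /\ altsum a b (/ t n k) (S n) = 0 else t n k = 0).
  { intros n k. apply (epsilon_spec (inhabits 0) (fun r =>
      if Nat.ltb k (2 * n + 1)
      then / y (S k) < r < / y k /\ altsum a b (/ r) (S n) = 0 else r = 0)).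
    apply inverse_root_exists. }
  clearbody t.
  assert (Hyi : forall k, 0 < / y k) by (intros k; apply Rinv_0_lt_compat, node_pos).
  assert (HtB : forall n k, 0 <= t n k <= root_bound k).
  { intros n k. specialize (Ht n k). pose proof (inverse_node_le_root_bound k).
    pose proof (Hyi k). pose proof (Hyi (S k)).
    destruct (Nat.ltb k (2 * n + 1)); lra. }
  assert (Hfactor : forall n z, Cprod (linear_factor (t n) z) (2 * n + 1)
      = sum_n (fun k => RtoC (coef a b k) * Cpow z k)%C (2 * n + 1)).
  { intros n.
    destruct (factor_from_roots (2 * n + 1)
                (truncation (coef a b) (2 * S n)) (t n)) as [c Hc].
    - rewrite truncation_length; lia.
    - intros k Hk. specialize (Ht n k).
      destruct (Nat.ltb_spec k (2 * n + 1)); [|lia].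
      pose proof (Hyi (S k)). split; [lra|].
      rewrite <- altsum_polynomial. apply Ht.
    - intros j k Hjk Hk E. pose proof (Ht n j) as Hj. specialize (Ht n k).
      destruct (Nat.ltb_spec k (2 * n + 1)); [|lia].
      destruct (Nat.ltb_spec j (2 * n + 1)); [|lia].
      assert (/ y k <= / y (S j)); [|lra].
      apply Rinv_le_contravar; [apply node_pos | apply node_le; lia].
    - replace (2 * S n)%nat with (S (2 * n + 1)) in Hc by lia.
      assert (Hc1 : c = 1).
      { specialize (Hc (RtoC 0)).
        rewrite (Cprod_ext _ (fun _ => RtoC 1)) in Hc
          by (intros; unfold linear_factor; ring).
        assert (E1 : forall m, Cprod (fun _ => RtoC 1) m = RtoC 1).
        { induction m as [|m IH]; simpl; [reflexivity|]. rewrite IH; ring. }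
        rewrite E1 in Hc. unfold truncation in Hc. simpl in Hc.
        apply RtoC_inj. rewrite Cmult_1_r in Hc. rewrite <- Hc. ring. }
      intros z. rewrite <- Ceval_truncation, Hc, Hc1. ring. }
  destruct (cluster_point t root_bound HtB) as [tau Htau].
  assert (Hbounds : forall k, / y (S k) <= tau k <= root_bound k).
  { intros k. apply (cluster_bounds t tau k _ _ k (Htau (S k))).
    intros n Hn. specialize (Ht n k). pose proof (inverse_node_le_root_bound k).
    destruct (Nat.ltb_spec k (2 * n + 1)); [lra | lia]. }
  exists tau. repeat split.
  - intros k. specialize (Hbounds k). pose proof (Hyi (S k)). lra.
  - apply (ex_series_le (K := R_AbsRing) (V := R_CompleteNormedModule) tau root_bound).
    + intros k. specialize (Hbounds k). pose proof (Hyi (S k)).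
      change (Rabs (tau k) <= root_bound k). rewrite Rabs_pos_eq; lra.
    + apply root_bound_summable.
  - intros z. apply (product_of_cluster t root_bound tau (fun n => (2 * n + 1)%nat));
      [exact HtB | apply root_bound_summable | intros n; lia | exact Htau |].
    apply (filterlim_ext (fun n =>
      sum_n (fun k => RtoC (coef a b k) * Cpow z k)%C (2 * n + 1))).
    { intros n; symmetry; apply Hfactor. }
    apply (filterlim_comp _ _ _ (fun n => (2 * n + 1)%nat)
      (sum_n (fun k => RtoC (coef a b k) * Cpow z k)%C) eventually eventually).
    + intros P [N HN]. exists N. intros n Hn. apply HN; lia.
    + apply HF.
Qed.

End Sufficiency.

(** * Normalisation of the first two coefficients *)

Lemma coefficients_of_quotients a b u : 0 < a -> 0 < b -> (forall k, 0 < u k) ->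
  (forall m, (1 <= m)%nat -> second_quotient u (2 * m) = a) ->
  (forall m, (1 <= m)%nat -> second_quotient u (2 * m + 1) = b) ->
  forall k, u k = u 0%nat * coef a b k * (u 1%nat / u 0%nat) ^ k.
Proof.
  intros Ha Hb Hu Qa Qb.
  assert (HQ : forall k, u (S (S k)) * quotient a b k = u (S k) * (u (S k) / u k)).
  { intros k.
    assert (E : second_quotient u (S (S k)) = quotient a b k).
    { destruct (parity k) as [m [-> | ->]]; unfold quotient.
      - rewrite Nat.even_mul. replace (S (S (2 * m))) with (2 * S m)%nat by lia.
        apply Qa; lia.
      - rewrite Nat.even_add, Nat.even_mul.
        replace (S (S (2 * m + 1))) with (2 * S m + 1)%nat by lia. apply Qb; lia. }
    rewrite <- E. unfold second_quotient.
    replace (S (S k) - 1)%nat with (S k) by lia. replace (S (S k) - 2)%nat with k by lia.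
    field. split; apply Rgt_not_eq, Hu. }
  assert (HS : forall k, u (S k) * ratio a b k = u k * (u 1%nat / u 0%nat)).
  { induction k as [|k IH].
    - simpl. field. apply Rgt_not_eq, Hu.
    - simpl ratio. replace (u (S (S k)) * (ratio a b k * quotient a b k))
        with (u (S (S k)) * quotient a b k * ratio a b k) by ring.
      rewrite HQ. replace (u (S k) * (u (S k) / u k) * ratio a b k)
        with (u (S k) / u k * (u (S k) * ratio a b k)) by ring.
      rewrite IH. field. split; apply Rgt_not_eq, Hu. }
  induction k as [|k IH]; [simpl; ring|].
  pose proof (ratio_pos a b k Ha Hb).
  apply Rmult_eq_reg_r with (ratio a b k); [|lra].
  rewrite HS, IH. simpl. field. split; [apply Rgt_not_eq, Hu | lra].
Qed.

(** The second quotients fix the coefficients once the first two are given; these two are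
    absorbed by the factor [c] and the scale [s]. *)
Lemma normal_form a b f : 0 < a -> 0 < b -> is_f_ab a b f ->
  exists (c s : R) (F : C -> C), 0 < c /\ 0 < s /\ is_entire_series (coef a b) F /\
    forall z, f z = (RtoC c * F (z * RtoC s))%C.
Proof.
  intros Ha Hb [u [Hu [Hf [Qa Qb]]]].
  pose proof (coefficients_of_quotients a b u Ha Hb Hu Qa Qb) as Hcoef.
  set (c := u 0%nat) in *. set (s := u 1%nat / c) in *.
  assert (Hc : 0 < c) by apply Hu.
  assert (Hs : 0 < s) by (apply Rdiv_lt_0_compat; [apply Hu | exact Hc]).
  assert (Hc' : RtoC c <> 0) by (intros E; apply RtoC_inj in E; lra).
  assert (Hs' : RtoC s <> 0) by (intros E; apply RtoC_inj in E; lra).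
  exists c, s, (fun z => / RtoC c * f (z / RtoC s))%C.
  repeat split; try assumption.
  - intros z.
    apply (is_series_ext (fun k => scal (/ RtoC c)%C (RtoC (u k) * Cpow (z / RtoC s) k)%C)).
    + intros k. change (/ RtoC c * (u k * (z / s) ^ k) = coef a b k * z ^ k)%C.
      rewrite Hcoef, !RtoC_mult, RtoC_pow. unfold Cdiv. rewrite Cpow_mult_l.
      replace (RtoC c * coef a b k * s ^ k * (z ^ k * (/ s) ^ k))%C
        with (RtoC c * coef a b k * z ^ k * (s ^ k * (/ s) ^ k))%C by ring.
      rewrite <- Cpow_mult_l, Cinv_r, Cpow_1_l by assumption. field; assumption.
    + apply (is_series_scal_l (K := C_AbsRing) (V := C_NormedModule) (/ RtoC c)%C), Hf.
  - intros z. replace (z * s / s)%C with z by (field; assumption). field; assumption.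
Qed.

(** The exponential factor is trivial: with the growth of the zeros, the product alone
    represents the function. *)
Lemma LPI_of_two_negative_sums a b x f : 1 <= a -> 1 <= b -> 1 < x -> x * x < a * b ->
  negative_sums a b x -> negative_sums b a x -> is_f_ab a b f -> LPI f.
Proof.
  intros Ha Hb Hx Hxab Hn Hn' Hf. split.
  { destruct Hf as [u [_ [Hu _]]]. exists u; exact Hu. }
  destruct (normal_form a b f ltac:(lra) ltac:(lra) Hf) as [c [s [F [Hc [Hs [HF Hf']]]]]].
  destruct (product_of_negative_sums a b x Ha Hb Hx Hxab Hn Hn' F HF)
    as [t [Ht [Hsum Hprod]]].
  exists c, 0, O, None, (fun k => / (s * t k)).
  assert (Hst : forall k, 0 < s * t k) by (intros k; specialize (Ht k); nra).
  repeat split; [lra | | |].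
  - intros k _. apply Rinv_0_lt_compat, Hst.
  - apply (ex_series_ext (fun k => s * t k)).
    + intros k. rewrite Rinv_inv. reflexivity.
    + apply (ex_series_scal_l s t Hsum).
  - intros z. exists (F (z * RtoC s)%C). split.
    + apply (filterlim_ext (Cprod (linear_factor t (z * RtoC s)%C))).
      * intros n. apply Cprod_ext. intros k _. unfold linear_factor, Cdiv.
        specialize (Hst k).
        rewrite <- RtoC_inv by (apply Rgt_not_eq, Rinv_0_lt_compat, Hst).
        rewrite Rinv_inv, RtoC_mult. ring.
      * apply Hprod.
    + rewrite Hf'. unfold Cexp.
      replace (0 * z)%C with (RtoC 0) by ring. simpl.
      rewrite exp_0, cos_0, sin_0. replace (1 * 1, 1 * 0) with (RtoC 1)
        by (unfold RtoC; f_equal; ring). ring.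
Qed.

(** * The partial theta function *)

(** The ratio test needs nonzero terms, hence the comparison with [r + 1]. *)
Lemma theta_term_summable s r : 1 < s -> 0 <= r -> ex_series (fun k => r ^ k / s ^ (k ^ 2)).
Proof.
  intros Hs Hr.
  apply (ex_series_le (K := R_AbsRing) (V := R_CompleteNormedModule) _
           (fun k => Rabs ((r + 1) ^ k / s ^ (k ^ 2)))).
  - intros k. change (Rabs (r ^ k / s ^ (k ^ 2)) <= Rabs ((r + 1) ^ k / s ^ (k ^ 2))).
    assert (0 < s ^ (k ^ 2)) by (apply pow_lt; lra).
    assert (0 <= r ^ k) by (apply pow_le; lra).
    assert (r ^ k <= (r + 1) ^ k) by (apply pow_incr; lra).
    assert (0 < / s ^ (k ^ 2)) by (apply Rinv_0_lt_compat; assumption).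
    rewrite !Rabs_pos_eq by (apply Rmult_le_pos; lra).
    apply Rmult_le_compat_r; lra.
  - apply (ex_series_DAlembert _ 0); [lra | |].
    + intros k. apply Rgt_not_eq, Rdiv_lt_0_compat; apply pow_lt; lra.
    + apply (is_lim_seq_ext (fun k => ((r + 1) / s) * (/ (s * s)) ^ k)).
      * intros k.
        assert (E : s ^ (S k ^ 2) = s ^ (k ^ 2) * (s * s) ^ k * s).
        { replace (S k ^ 2)%nat with (k ^ 2 + (2 * k + 1))%nat by (simpl; lia).
          rewrite pow_add, pow_add, pow_mult. simpl. rewrite !Rmult_1_r. ring. }
        rewrite E.
        assert (0 < s ^ (k ^ 2)) by (apply pow_lt; lra).
        assert (0 < (s * s) ^ k) by (apply pow_lt; nra).
        assert (0 < (r + 1) ^ k) by (apply pow_lt; lra).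
        rewrite pow_inv.
        replace ((r + 1) ^ S k / (s ^ (k ^ 2) * (s * s) ^ k * s) / ((r + 1) ^ k / s ^ (k ^ 2)))
          with ((r + 1) / s * / (s * s) ^ k).
        2: { simpl pow at 2. field. repeat split; lra. }
        rewrite Rabs_pos_eq; [reflexivity|].
        apply Rmult_le_pos; [apply Rlt_le, Rdiv_lt_0_compat; lra|].
        left; apply Rinv_0_lt_compat; assumption.
      * replace (Finite 0) with (Rbar_mult ((r + 1) / s) 0)
          by (simpl; f_equal; ring).
        apply (is_lim_seq_scal_l _ ((r + 1) / s) 0).
        apply is_lim_seq_geom. rewrite Rabs_pos_eq.
        -- rewrite <- Rinv_1. apply Rinv_lt_contravar; nra.
        -- left; apply Rinv_0_lt_compat; nra.
Qed.

Lemma sum_n_C (v : nat -> C) n :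
  sum_n v n = (sum_n (fun k => Re (v k)) n, sum_n (fun k => Im (v k)) n).
Proof.
  induction n as [|n IH].
  - rewrite !sum_O. destruct (v O); reflexivity.
  - rewrite !sum_Sn, IH. reflexivity.
Qed.

Lemma filterlim_components (p q : nat -> R) (l m : R) :
  is_lim_seq p l -> is_lim_seq q m ->
  filterlim (fun n => (p n, q n) : C) eventually (locally ((l, m) : C)).
Proof.
  intros Hp Hq. apply is_lim_seq_spec in Hp. apply is_lim_seq_spec in Hq.
  apply (proj2 (filterlim_locally
    (U := prod_UniformSpace R_UniformSpace R_UniformSpace)
    (fun n => (p n, q n)) (l, m))).
  intros eps. generalize (filter_and _ _ (Hp eps) (Hq eps)).
  apply filter_imp. intros n [H1 H2]. split; assumption.
Qed.

Lemma is_series_CSeries (v : nat -> C) :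
  ex_series (fun k => Cmod (v k)) ->
  is_series (K := C_AbsRing) (V := C_NormedModule) v (CSeries v).
Proof.
  intros H.
  assert (Hc : forall (g : C -> R), (forall z, Rabs (g z) <= Cmod z) ->
            ex_series (fun k => g (v k))).
  { intros g Hg. apply (ex_series_le (K := R_AbsRing) (V := R_CompleteNormedModule) _
      (fun k => Cmod (v k))); [|exact H]. intros k. apply Hg. }
  assert (HRe := Series_correct _ (Hc Re re_le_Cmod)).
  assert (HIm := Series_correct _ (Hc Im (fun z =>
     Rle_trans _ _ _ (Rmax_r _ _) (Rmax_Cmod z)))).
  unfold is_series, CSeries.
  apply (filterlim_ext (fun n =>
    (sum_n (fun k => Re (v k)) n, sum_n (fun k => Im (v k)) n))).
  { intros n; symmetry; apply sum_n_C. }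
  apply filterlim_components; assumption.
Qed.

Lemma partial_theta_is_f s : 1 < s -> is_f_ab (s ^ 2) (s ^ 2) (partial_theta s).
Proof.
  intros Hs. exists (fun k => / s ^ (k ^ 2)).
  assert (Hpow : forall n, 0 < s ^ n) by (intros n; apply pow_lt; lra).
  assert (HQ : forall k, second_quotient (fun k => / s ^ (k ^ 2)) (S (S k)) = s ^ 2).
  { intros k. unfold second_quotient.
    replace (S (S k) - 1)%nat with (S k) by lia. replace (S (S k) - 2)%nat with k by lia.
    replace (S (S k) ^ 2)%nat with (k ^ 2 + 4 * k + 4)%nat by (simpl; lia).
    replace (S k ^ 2)%nat with (k ^ 2 + 2 * k + 1)%nat by (simpl; lia).
    rewrite !pow_add. replace (4 * k)%nat with (2 * k + 2 * k)%nat by lia. rewrite pow_add.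
    pose proof (Hpow (k ^ 2)%nat). pose proof (Hpow (2 * k)%nat).
    set (A := s ^ (k ^ 2)) in *. set (B := s ^ (2 * k)) in *.
    simpl. field. repeat split; lra. }
  repeat split.
  - intros k. apply Rinv_0_lt_compat, Hpow.
  - intros z. unfold partial_theta.
    assert (E : forall k, (Cpow z k * / RtoC (s ^ (k ^ 2)))%C
                          = (RtoC (/ s ^ (k ^ 2)) * Cpow z k)%C).
    { intros k. rewrite RtoC_inv by (apply Rgt_not_eq, Hpow). ring. }
    apply (is_series_ext (fun k => (Cpow z k * / RtoC (s ^ (k ^ 2)))%C)); [exact E|].
    apply is_series_CSeries.
    apply (ex_series_ext (fun k => Cmod z ^ k / s ^ (k ^ 2))).
    + intros k. rewrite E, Cmod_mult, Cmod_R, Cmod_pow, Rabs_pos_eq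
        by (left; apply Rinv_0_lt_compat, Hpow).
      apply Rmult_comm.
    + apply theta_term_summable; [exact Hs | apply Cmod_ge_0].
  - intros m Hm. destruct m as [|m]; [lia|].
    replace (2 * S m)%nat with (S (S (2 * m))) by lia. apply HQ.
  - intros m Hm. destruct m as [|m]; [lia|].
    replace (2 * S m + 1)%nat with (S (S (2 * m + 1))) by lia. apply HQ.
Qed.

(** * From type I to the Laguerre-Polya class *)

Lemma Cexp_plus z w : Cexp (z + w) = (Cexp z * Cexp w)%C.
Proof.
  unfold Cexp. destruct z as [a b], w as [c d]. unfold Cplus, Cmult, Re, Im; simpl.
  rewrite exp_plus, cos_plus, sin_plus. f_equal; ring.
Qed.

Lemma Cexp_R x : Cexp (RtoC x) = RtoC (exp x).
Proof. unfold Cexp, RtoC; simpl. rewrite cos_0, sin_0. f_equal; ring. Qed.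

Lemma Cexp_0 : Cexp 0 = 1.
Proof. rewrite Cexp_R, exp_0. reflexivity. Qed.

Lemma Cprod_mult F G n : Cprod (fun k => F k * G k)%C n = (Cprod F n * Cprod G n)%C.
Proof. induction n as [|n IH]; simpl; [|rewrite IH]; ring. Qed.

Lemma Cprod_Cexp z t n :
  Cprod (fun k => Cexp (z * RtoC (t k))) n = Cexp (z * RtoC (Rsum t n)).
Proof.
  induction n as [|n IH]; simpl.
  - rewrite Cmult_0_r, Cexp_0. reflexivity.
  - rewrite IH, <- Cexp_plus, RtoC_plus. f_equal; ring.
Qed.

Lemma filterlim_Cmult (u v : nat -> C) (l m : C) :
  filterlim u eventually (locally l) -> filterlim v eventually (locally m) ->
  filterlim (fun n => u n * v n)%C eventually (locally (l * m)%C).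
Proof.
  intros Hu Hv. apply filterlim_Cmod.
  rewrite filterlim_Cmod in Hu, Hv. intros eps Heps.
  pose proof (Cmod_ge_0 l). pose proof (Cmod_ge_0 m).
  set (d := Rmin 1 (eps / (Cmod l + Cmod m + 2))).
  assert (Hd0 : 0 < eps / (Cmod l + Cmod m + 2)) by (apply Rdiv_lt_0_compat; lra).
  assert (Hd : 0 < d) by (apply Rmin_glb_lt; lra).
  assert (Hd1 : d <= 1) by apply Rmin_l.
  assert (Hd2 : d * (Cmod l + Cmod m + 2) <= eps).
  { apply Rle_trans with (eps / (Cmod l + Cmod m + 2) * (Cmod l + Cmod m + 2)).
    - apply Rmult_le_compat_r; [lra | apply Rmin_r].
    - right; field; lra. }
  destruct (Hu d Hd) as [N1 H1], (Hv d Hd) as [N2 H2].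
  exists (Nat.max N1 N2). intros n Hn.
  specialize (H1 n ltac:(lia)). specialize (H2 n ltac:(lia)).
  replace (u n * v n - l * m)%C
    with ((u n - l) * (v n - m) + (u n - l) * m + l * (v n - m))%C by ring.
  eapply Rle_lt_trans; [apply Cmod_triangle|].
  eapply Rle_lt_trans; [apply Rplus_le_compat_r, Cmod_triangle|].
  rewrite !Cmod_mult.
  pose proof (Cmod_ge_0 (u n - l)). pose proof (Cmod_ge_0 (v n - m)).
  assert (Cmod (u n - l) * Cmod (v n - m) <= d * 1) by (apply Rmult_le_compat; lra).
  assert (Cmod (u n - l) * Cmod m <= d * Cmod m) by (apply Rmult_le_compat_r; lra).
  assert (Cmod l * Cmod (v n - m) <= Cmod l * d) by (apply Rmult_le_compat_l; lra).
  nra.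
Qed.

Lemma filterlim_Cexp_real z (s : nat -> R) (l : R) : is_lim_seq s l ->
  filterlim (fun n => Cexp (z * RtoC (s n))) eventually (locally (Cexp (z * RtoC l))).
Proof.
  intros Hs.
  assert (Hcont : forall g : R -> R, continuity g -> is_lim_seq (fun n => g (s n)) (g l)).
  { intros g Hg. apply is_lim_seq_continuous; [apply Hg | exact Hs]. }
  assert (E : forall r, Cexp (z * RtoC r)
     = (exp (Re z * r) * cos (Im z * r), exp (Re z * r) * sin (Im z * r))).
  { intros r. unfold Cexp. destruct z as [p q]; unfold Cmult, RtoC, Re, Im; simpl.
    replace (p * r - q * 0) with (p * r) by ring.
    replace (p * 0 + q * r) with (q * r) by ring. reflexivity. }
  assert (Hlin : forall c, continuity (fun r => c * r)).
  { intros c. apply (continuity_scal id), derivable_continuous, derivable_id. }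
  assert (He : continuity (fun r => exp (Re z * r))).
  { apply (continuity_comp (fun r => Re z * r) exp); [apply Hlin|].
    apply derivable_continuous, derivable_exp. }
  assert (H1 := Hcont _ (continuity_mult _ _ He
     (continuity_comp (fun r => Im z * r) cos (Hlin _) continuity_cos))).
  assert (H2 := Hcont _ (continuity_mult _ _ He
     (continuity_comp (fun r => Im z * r) sin (Hlin _) continuity_sin))).
  apply (filterlim_ext (fun n =>
    (exp (Re z * s n) * cos (Im z * s n), exp (Re z * s n) * sin (Im z * s n)))).
  { intros n; symmetry; apply E. }
  rewrite E. apply filterlim_components; assumption.
Qed.

(** The inverses are bounded by their sum, so the squares are dominated by a multiple of a
    summable sequence. *)
Lemma summable_inverse_squares (x : nat -> R) : (forall k, 0 < x k) ->
  ex_series (fun k => / x k) -> ex_series (fun k => / (- x k) ^ 2).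
Proof.
  intros Hx [s Hs].
  assert (Hpos : forall k, 0 < / x k) by (intros k; apply Rinv_0_lt_compat, Hx).
  assert (Hle : forall k, / x k <= s).
  { intros k. apply Rle_trans with (Rsum (fun k => / x k) (S k)).
    - simpl. assert (0 <= Rsum (fun k => / x k) k)
        by (apply Rsum_nonneg; intros; left; apply Hpos). lra.
    - apply Rsum_le_series; [intros; left; apply Hpos | exact Hs]. }
  apply (ex_series_le (K := R_AbsRing) (V := R_CompleteNormedModule) _
           (fun k => s * / x k)).
  - intros k. change (Rabs (/ (- x k) ^ 2) <= s * / x k).
    specialize (Hx k). specialize (Hpos k). specialize (Hle k).
    replace (/ (- x k) ^ 2) with (/ x k * / x k) by (field; lra).
    rewrite Rabs_pos_eq by nra. apply Rmult_le_compat_r; lra.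
  - apply (ex_series_scal_l s (fun k => / x k)). exists s; exact Hs.
Qed.

(** The convergence factors [exp (z / x_k)] multiply to the exponential of a linear function,
    which is compensated by changing [beta]. *)
Lemma LPI_LP f : LPI f -> LP f.
Proof.
  intros [Hf [c [beta [n [N [x [_ [Hx [Hsum Hprod]]]]]]]]].
  split; [exact Hf|].
  set (s := match N with Some m => Rsum (fun k => / x k) m
                       | None => Series (fun k => / x k) end).
  exists c, 0, (beta + s), n, N, (fun k => - x k).
  assert (Hfactor : forall z k, in_range N k ->
    ((1 - z / RtoC (- x k)) * Cexp (z * / RtoC (- x k)))%C
    = ((1 + z / x k) * Cexp (- z * RtoC (/ x k)))%C).
  { intros z k Hk. specialize (Hx k Hk).
    assert (RtoC (x k) <> 0) by (intros E; apply RtoC_inj in E; lra).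
    rewrite RtoC_inv by lra. rewrite RtoC_opp.
    replace (z * / - RtoC (x k))%C with (- z * / x k)%C by (field; assumption).
    replace (z / - RtoC (x k))%C with (- (z / x k))%C by (field; assumption). ring. }
  repeat split.
  - lra.
  - intros k Hk. specialize (Hx k Hk). lra.
  - destruct N as [m|]; [exact I|]. simpl in *.
    apply summable_inverse_squares; [intros k; apply Hx; exact I | exact Hsum].
  - intros z. destruct (Hprod z) as [P [HP Hfz]].
    exists (P * Cexp (- z * RtoC s))%C. split.
    + destruct N as [m|]; simpl in *.
      * subst P. unfold s. rewrite <- Cprod_Cexp, <- Cprod_mult.
        apply Cprod_ext. intros k Hk. symmetry. apply Hfactor, Hk.
      * apply (filterlim_ext (fun n => Cprod (fun k => 1 + z / x k) n
                                 * Cexp (- z * RtoC (Rsum (fun k => / x k)%R n)))%C).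
        { intros m. rewrite <- Cprod_Cexp, <- Cprod_mult. apply Cprod_ext.
          intros k _. symmetry. apply Hfactor; exact I. }
        apply filterlim_Cmult; [exact HP|]. apply filterlim_Cexp_real.
        apply is_lim_seq_incr_1.
        apply (is_lim_seq_ext (sum_n (fun k => / x k))).
        { intros m. symmetry; apply Rsum_sum_n. }
        apply Series_correct, Hsum.
    + rewrite Hfz. rewrite RtoC_plus.
      replace (- 0 * z ^ 2 + (beta + s) * z)%C with (beta * z + s * z)%C by ring.
      rewrite Cexp_plus.
      replace (c * z ^ n * (Cexp (beta * z) * Cexp (s * z)) * (P * Cexp (- z * s)))%C
        with (c * z ^ n * Cexp (beta * z) * P * (Cexp (s * z) * Cexp (- z * s)))%C by ring.
      rewrite <- Cexp_plus. replace (s * z + - z * s)%C with (RtoC 0) by ring.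
      rewrite Cexp_0. ring.
Qed.

(** * Upper bound for a function of the Laguerre-Polya class *)

Lemma filterlim_RtoC (s : nat -> R) (l : C) :
  filterlim (fun n => RtoC (s n)) eventually (locally l) ->
  is_lim_seq s (Re l) /\ l = RtoC (Re l).
Proof.
  intros H. rewrite filterlim_Cmod in H. split.
  - apply is_lim_seq_spec. intros eps.
    destruct (H eps (cond_pos eps)) as [N HN]. exists N. intros n Hn.
    eapply Rle_lt_trans; [|apply (HN n Hn)].
    replace (s n - Re l) with (Re (RtoC (s n) - l)%C) by reflexivity.
    apply re_le_Cmod.
  - assert (Im l = 0).
    { apply Rabs_eq_0. apply Rle_antisym; [|apply Rabs_pos].
      apply Rnot_lt_le. intros Hlt.
      destruct (H _ Hlt) as [N HN]. specialize (HN N ltac:(lia)).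
      assert (Rabs (Im l) <= Cmod (RtoC (s N) - l)%C); [|lra].
      replace (Rabs (Im l)) with (Rabs (Im (RtoC (s N) - l)%C))
        by (simpl; rewrite Rplus_0_l, Rabs_Ropp; reflexivity).
      eapply Rle_trans; [apply Rmax_r | apply Rmax_Cmod]. }
    destruct l as [p q]; simpl in *. unfold RtoC. congruence.
Qed.

Lemma sum_n_RtoC (v : nat -> R) n : sum_n (fun k => RtoC (v k)) n = RtoC (sum_n v n).
Proof.
  induction n as [|n IH]; [rewrite !sum_O; reflexivity|].
  rewrite !sum_Sn, IH. symmetry. apply RtoC_plus.
Qed.

Lemma entire_series_real u f x : is_entire_series u f ->
  is_series (fun k => u k * x ^ k) (Re (f (RtoC x))) /\ f (RtoC x) = RtoC (Re (f (RtoC x))).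
Proof.
  intros Hf. apply filterlim_RtoC.
  apply (filterlim_ext (sum_n (fun k => (RtoC (u k) * Cpow (RtoC x) k)%C))).
  - intros n. rewrite <- sum_n_RtoC. apply sum_n_ext. intros k.
    rewrite RtoC_mult, RtoC_pow. reflexivity.
  - apply Hf.
Qed.

Lemma C_lim_unique (u : nat -> C) (l m : C) :
  filterlim u eventually (locally l) -> filterlim u eventually (locally m) -> l = m.
Proof.
  intros Hl Hm.
  exact (@filterlim_locally_unique _ C_AbsRing C_NormedModule eventually _ u l m Hl Hm).
Qed.

(** Treats finite and infinite products at once. It gives the value [1] at the origin and
    the value [0] at a zero of a factor. *)
Lemma is_product_eventually N F P v m : is_product N F P ->
  (match N with Some n => m <= n | None => True end)%nat ->
  (forall n, (m <= n)%nat -> Cprod F n = v) -> P = v.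
Proof.
  destruct N as [n|]; simpl; intros HP Hm Hv.
  - rewrite HP. apply Hv, Hm.
  - apply (C_lim_unique (Cprod F)); [exact HP|].
    apply filterlim_Cmod. intros eps Heps. exists m. intros n Hn.
    rewrite Hv by exact Hn. replace (v - v)%C with (RtoC 0) by ring.
    rewrite Cmod_0. exact Heps.
Qed.

Lemma Cprod_zero F k n : F k = RtoC 0 -> (S k <= n)%nat -> Cprod F n = RtoC 0.
Proof.
  intros HF H. induction H as [|n H IH]; simpl; [rewrite HF | rewrite IH]; ring.
Qed.

Lemma is_product_Re_le_1 N F (g : nat -> R) P : is_product N F P ->
  (forall k, in_range N k -> F k = RtoC (g k) /\ 0 <= g k <= 1) ->
  exists p, P = RtoC p /\ p <= 1.
Proof.
  intros HP HF.
  assert (H : forall n, (match N with Some m => n <= m | None => True end)%nat ->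
            exists p, Cprod F n = RtoC p /\ 0 <= p <= 1).
  { induction n as [|n IH]; intros Hn; simpl.
    - exists 1; split; [reflexivity | lra].
    - destruct IH as [p [Ep Hp]]; [destruct N; lia || exact I|].
      destruct (HF n) as [Eg Hg]; [destruct N; simpl; lia || exact I|].
      exists (p * g n). rewrite Ep, Eg, RtoC_mult. split; [reflexivity | nra]. }
  destruct N as [n|]; simpl in HP.
  - destruct (H n (le_n n)) as [p [Ep Hp]]. exists p. rewrite HP. split; [exact Ep | lra].
  - assert (E : forall n, Cprod F n = RtoC (Re (Cprod F n)) /\ Re (Cprod F n) <= 1).
    { intros n. destruct (H n I) as [p [-> Hp]]. simpl. split; [reflexivity | lra]. }
    destruct (filterlim_RtoC (fun n => Re (Cprod F n)) P) as [H1 H2].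
    { apply (filterlim_ext (Cprod F)); [intros n; apply E | exact HP]. }
    exists (Re P). split; [exact H2|].
    change (Rbar_le (Re P) 1).
    apply (is_lim_seq_le (fun n => Re (Cprod F n)) (fun _ => 1) (Re P) 1);
      [intros n; apply E | exact H1 | apply is_lim_seq_const].
Qed.

Lemma exp_factor_le_1 y : y <= 1 -> 0 <= (1 - y) * exp y <= 1.
Proof.
  intros Hy. pose proof (exp_pos y). split; [apply Rmult_le_pos; lra|].
  pose proof (exp_ineq1_le (- y)).
  apply Rle_trans with (exp (- y) * exp y); [apply Rmult_le_compat_r; lra|].
  rewrite <- exp_plus. replace (- y + y) with 0 by ring. rewrite exp_0; lra.
Qed.

(** Each factor [(1 - y) exp y] with [y <= 1] lies in [0, 1], and [exp (- alpha t^2) <= 1].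
    If some factor had [y > 1] at [t], then the corresponding zero would lie between [0] and
    [t]. So, as long as no zero has been crossed, only the factor [c exp (B t)] matters. *)
Lemma LP_le_exp f c : LP f -> 0 < c -> f (RtoC 0) = RtoC c ->
  exists B, forall t : R, (forall s, 0 < s <= 1 -> f (RtoC (s * t)) <> RtoC 0) ->
    Re (f (RtoC t)) <= c * exp (B * t).
Proof.
  intros [_ [c' [alpha [B [n [N [x [Halpha [Hx [_ Hprod]]]]]]]]]] Hc Hf0.
  assert (Hn : n = O /\ c' = c).
  { destruct (Hprod (RtoC 0)) as [P [HP Hf]].
    assert (EP : P = RtoC 1).
    { apply (is_product_eventually N _ P (RtoC 1) 0 HP); [destruct N; lia || exact I|].
      intros m _. induction m as [|m IH]; [reflexivity|]. simpl. rewrite IH.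
      unfold Cdiv. rewrite !Cmult_0_l, Cexp_0. ring. }
    rewrite Hf0, EP in Hf.
    replace (- alpha * 0 ^ 2 + B * 0)%C with (RtoC 0) in Hf by (simpl; ring).
    rewrite Cexp_0 in Hf. destruct n as [|n].
    - split; [reflexivity|]. apply RtoC_inj. rewrite Hf; simpl; ring.
    - exfalso. assert (RtoC c = RtoC 0) by (rewrite Hf; simpl; ring).
      apply RtoC_inj in H; lra. }
  destruct Hn as [-> ->]. exists B. intros t Ht.
  assert (Hy : forall k, in_range N k -> t / x k <= 1).
  { intros k Hk. apply Rnot_lt_le. intros Hlt. specialize (Hx k Hk).
    assert (Ht0 : t <> 0) by (intros ->; unfold Rdiv in Hlt; lra).
    apply (Ht (/ (t / x k))).
    - split; [apply Rinv_0_lt_compat; lra|].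
      rewrite <- Rinv_1. apply Rinv_le_contravar; lra.
    - replace (/ (t / x k) * t) with (x k) by (field; split; assumption).
      destruct (Hprod (RtoC (x k))) as [P [HP Hf]].
      rewrite Hf, (is_product_eventually N _ P (RtoC 0) (S k) HP).
      + ring.
      + destruct N as [m|]; [exact Hk | exact I].
      + intros m Hm. apply (Cprod_zero _ k); [|exact Hm].
        unfold Cdiv. rewrite Cinv_r by (intros E; apply RtoC_inj in E; contradiction).
        ring. }
  destruct (Hprod (RtoC t)) as [P [HP Hf]].
  destruct (is_product_Re_le_1 N _ (fun k => (1 - t / x k) * exp (t / x k)) P HP)
    as [p [-> Hp]].
  { intros k Hk. specialize (Hx k Hk). split; [|apply exp_factor_le_1, Hy, Hk].
    rewrite RtoC_mult, RtoC_minus, <- Cexp_R, RtoC_div by assumption. reflexivity. }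
  rewrite Hf. replace (- alpha * t ^ 2 + B * t)%C with (RtoC (- alpha * t ^ 2 + B * t))
    by (rewrite RtoC_plus, !RtoC_mult, RtoC_opp, RtoC_pow; reflexivity).
  rewrite Cexp_R.
  replace (RtoC c * RtoC t ^ 0 * RtoC (exp (- alpha * t ^ 2 + B * t)) * RtoC p)%C
    with (RtoC (c * exp (- alpha * t ^ 2 + B * t) * p))
    by (rewrite !RtoC_mult; simpl; ring).
  simpl Re.
  assert (He : exp (- alpha * t ^ 2 + B * t) <= exp (B * t)).
  { assert (H : - alpha * t ^ 2 + B * t <= B * t)
      by (assert (0 <= alpha * t ^ 2) by (apply Rmult_le_pos; [exact Halpha | nra]); nra).
    destruct H as [H|H]; [left; apply exp_increasing, H | rewrite H; lra]. }
  pose proof (exp_pos (- alpha * t ^ 2 + B * t)).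
  apply Rle_trans with (c * exp (- alpha * t ^ 2 + B * t) * 1).
  - apply Rmult_le_compat_l; [|exact Hp]. apply Rmult_le_pos; lra.
  - rewrite Rmult_1_r. apply Rmult_le_compat_l; lra.
Qed.

(** * A zero close to the origin *)

Lemma exp_opp_le_quadratic x : 0 <= x -> exp (- x) <= 1 - x + x ^ 2 / 2.
Proof.
  intros [Hx|<-]; [|rewrite Ropp_0, exp_0; lra].
  destruct (MVT_cor2 (fun t => 1 - t + t ^ 2 / 2 - exp (- t))
              (fun t => - 1 + t + exp (- t)) 0 x Hx) as [c [Hc [Hc0 _]]].
  - intros t _. apply is_derive_Reals. auto_derive; [exact I | simpl; field].
  - pose proof (exp_ineq1_le (- c)).
    assert (0 <= (- 1 + c + exp (- c)) * (x - 0)) by (apply Rmult_le_pos; lra).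
    rewrite <- Hc in H0. rewrite Ropp_0, exp_0 in H0. lra.
Qed.

Lemma altsum_1 a b x : altsum a b x 1 = 1 - x.
Proof. unfold altsum, pair_diff, term; simpl. field. Qed.

Lemma altsum_2 a b x : 0 < a -> 0 < b -> altsum a b x 2 = 1 - x + x ^ 2 / a - x ^ 3 / (a ^ 2 * b).
Proof. intros. unfold altsum, pair_diff, term, quotient; simpl. unfold quotient; simpl. field. lra. Qed.

Lemma altsum_3_at_a a b : 0 < a -> 0 < b ->
  altsum a b a 3 = 1 - a / b + / b ^ 2 - / (a * b ^ 4).
Proof. intros. unfold altsum, pair_diff, term, quotient; simpl. unfold quotient; simpl. field. lra. Qed.

(** The right side is smallest, for given [a], when [b = a], where it equals
    [a^-2 - a^-5]; and [exp a] exceeds a multiple of [a^2] with factor larger than [8/7],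
    by [exp (a / 2) = e exp (a / 2 - 1) >= e a / 2]. *)
Lemma exp_neg_lt_altsum_3 a b : 2 <= a -> a <= b -> exp (- a) < altsum a b a 3.
Proof.
  intros Ha Hab. rewrite altsum_3_at_a by lra.
  set (v := / a). set (u := / b).
  assert (Hv : 0 < v <= / 2).
  { split; [apply Rinv_0_lt_compat; lra | apply Rinv_le_contravar; lra]. }
  assert (Hu : 0 < u <= v).
  { split; [apply Rinv_0_lt_compat; lra | apply Rinv_le_contravar; lra]. }
  assert (Hav : a * v = 1) by (unfold v; field; lra).
  replace (1 - a / b + / b ^ 2 - / (a * b ^ 4)) with (1 - a * u + u ^ 2 - v * u ^ 4)
    by (unfold u, v; field; lra).
  apply Rlt_le_trans with (v ^ 2 - v ^ 5).
  (* [exp 1 >= (5/4)^4], and [((5/4)^4 / 2)^2 > 1.49] *)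
  - assert (He : (a ^ 2) * 149 / 100 <= exp a).
    { assert (E1 : 5 / 4 <= exp (1 / 4)) by (pose proof (exp_ineq1_le (1 / 4)); lra).
      assert (E2 : a / 2 <= exp (a / 2 - 1)) by (pose proof (exp_ineq1_le (a / 2 - 1)); lra).
      assert (E3 : exp (a / 2) = exp (a / 2 - 1) * exp (1 / 4) ^ 4).
      { simpl. rewrite Rmult_1_r, <- !exp_plus. f_equal. lra. }
      assert (E4 : (5 / 4) ^ 4 <= exp (1 / 4) ^ 4) by (apply pow_incr; lra).
      assert (E5 : a / 2 * (5 / 4) ^ 4 <= exp (a / 2)).
      { rewrite E3. apply Rmult_le_compat; try lra. }
      assert (E6 : exp a = exp (a / 2) * exp (a / 2))
        by (rewrite <- exp_plus; f_equal; lra).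
      rewrite E6. apply Rle_trans with (a / 2 * (5 / 4) ^ 4 * (a / 2 * (5 / 4) ^ 4)).
      - assert (0 < a ^ 2) by nra. nra.
      - apply Rmult_le_compat; nra. }
    apply Rmult_lt_reg_r with (exp a); [apply exp_pos|].
    rewrite <- exp_plus, Rplus_opp_l, exp_0.
    assert (Hv3 : v ^ 3 <= / 8) by (assert (v * v <= / 4) by nra; simpl; nra).
    assert (Hpos : 0 <= v ^ 2 - v ^ 5).
    { replace (v ^ 2 - v ^ 5) with (v ^ 2 * (1 - v ^ 3)) by ring.
      apply Rmult_le_pos; [nra | lra]. }
    apply Rlt_le_trans with ((v ^ 2 - v ^ 5) * (a ^ 2 * 149 / 100)).
    + replace ((v ^ 2 - v ^ 5) * (a ^ 2 * 149 / 100))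
        with ((a * v) ^ 2 * (1 - v ^ 3) * 149 / 100) by field.
      rewrite Hav. lra.
    + apply Rmult_le_compat_l; assumption.
  - cut (0 <= 1 - a * u + u ^ 2 - v * u ^ 4 - (v ^ 2 - v ^ 5)); [lra|].
    replace (1 - a * u + u ^ 2 - v * u ^ 4 - (v ^ 2 - v ^ 5))
      with ((v - u) * (a - (u + v) + v * (u + v) * (u ^ 2 + v ^ 2)) + (1 - a * v)) by ring.
    rewrite Hav.
    assert (0 <= (v - u) * (a - (u + v) + v * (u + v) * (u ^ 2 + v ^ 2))); [|lra].
    apply Rmult_le_pos; [lra|].
    assert (0 <= v * (u + v) * (u ^ 2 + v ^ 2)) by (repeat apply Rmult_le_pos; nra). lra.
Qed.

Lemma altsum_converges a b F x : is_entire_series (coef a b) F ->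
  is_lim_seq (altsum a b x) (Re (F (RtoC (- x)))).
Proof.
  intros HF. destruct (entire_series_real _ _ (- x) HF) as [H _].
  apply is_lim_seq_incr_1.
  apply (is_lim_seq_ext
    (fun N => sum_n (fun k => coef a b k * (- x) ^ k) (2 * N + 1))).
  - intros N. rewrite altsum_polynomial, Reval_truncation, <- Rsum_sum_n.
    f_equal; lia.
  - apply (is_lim_seq_subseq (sum_n (fun k => coef a b k * (- x) ^ k)) _
             (fun N => (2 * N + 1)%nat)); [|exact H].
    intros P [N HN]. exists N. intros n Hn. apply HN; lia.
Qed.

Lemma altsum_le_limit a b x (l : R) N : 1 <= a -> 1 < b -> 0 < x -> x <= a -> (1 <= N)%nat ->
  is_lim_seq (altsum a b x) l -> altsum a b x N <= l.
Proof.
  intros Ha Hb Hx Hxa HN Hl. change (Rbar_le (altsum a b x N) l).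
  apply (is_lim_seq_le_loc (fun _ => altsum a b x N) (altsum a b x) (altsum a b x N) l).
  - exists N. intros n Hn. apply altsum_growing; assumption.
  - apply is_lim_seq_const.
  - exact Hl.
Qed.

(** In normalised form [F = 1 + z + z^2 / a + ...] and, before the first zero,
    [F t <= exp (B t)]. For small [t > 0] this forces [B >= 1], so on the negative side
    [F (- x) <= exp (- x)]. Comparing second order terms at [0] gives [a >= 2]. Without a
    zero on [[- a, 0)] the inequality would hold at [x = a], where the value of the series
    is too large. A zero [- x] with [1 < x < a] makes all the partial sums negative,
    because they increase to the value [0]. *)
Lemma negative_sums_of_LP a b f : 1 < a -> a <= b -> is_f_ab a b f -> LP f ->
  2 <= a /\ exists x, 1 < x < a /\ negative_sums a b x.
Proof.
  intros Ha Hab Hf HLP.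
  destruct (normal_form a b f ltac:(lra) ltac:(lra) Hf) as [c [s [F [Hc [Hs [HF Hf']]]]]].
  assert (HFreal : forall t, F (RtoC t) = RtoC (Re (F (RtoC t))))
    by (intros t; apply (entire_series_real _ _ t HF)).
  assert (Hfs : forall t, f (RtoC (t / s)) = RtoC (c * Re (F (RtoC t)))).
  { intros t. rewrite Hf', RtoC_mult, <- HFreal, <- RtoC_mult.
    f_equal. f_equal. f_equal. field; lra. }
  assert (HF0 : Re (F (RtoC 0)) = 1).
  { destruct (entire_series_real _ _ 0 HF) as [H0 _].
    apply is_series_unique in H0. rewrite <- H0.
    apply is_series_unique.
    apply (is_series_ext (fun k => match k with O => 1 | S _ => 0 end)).
    - intros [|k]; simpl; ring.
    - apply (filterlim_ext (fun _ => 1)).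
      + intros n. rewrite <- Rsum_sum_n. induction n as [|n IH]; [simpl; ring|].
        simpl in *. lra.
      + apply filterlim_const. }
  destruct (LP_le_exp f c HLP Hc) as [B' HB'].
  { replace 0 with (0 / s) by (field; lra). rewrite Hfs, HF0. f_equal; ring. }
  set (B := B' / s).
  assert (HB : forall t, (forall r, 0 < r <= 1 -> Re (F (RtoC (r * t))) <> 0) ->
             Re (F (RtoC t)) <= exp (B * t)).
  { intros t Ht. specialize (HB' (t / s)). rewrite Hfs in HB'. simpl in HB'.
    apply Rmult_le_reg_l with c; [exact Hc|].
    replace (B * t) with (B' * (t / s)) by (unfold B; field; lra).
    apply HB'. intros r Hr E.
    replace (r * (t / s)) with (r * t / s) in E by (field; lra).
    rewrite Hfs in E. apply RtoC_inj in E. apply (Ht r Hr).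
    apply Rmult_integral in E; destruct E as [E|E]; [lra | exact E]. }
  clear HB' Hfs.
  assert (Hright : forall t, 0 <= t -> 1 + t <= Re (F (RtoC t))).
  { intros t Ht. destruct (entire_series_real _ _ t HF) as [H0 _].
    replace (1 + t) with (Rsum (fun k => coef a b k * t ^ k) 2)
      by (simpl; field).
    apply Rsum_le_series; [|exact H0].
    intros k. apply Rmult_le_pos; [left; apply coef_pos; lra | apply pow_le, Ht]. }
  (* [(1 + t)(1 - B t) <= (1 + t) exp (- B t) <= 1] gives [1 - B <= B t] for every [t > 0] *)
  assert (HB1 : 1 <= B).
  { apply Rnot_lt_le. intros Hlt.
    set (t := (1 - B) / (2 * (Rabs B + 1))).
    pose proof (Rabs_pos B) as HA. pose proof (Rle_abs B) as HA'.
    assert (Ht : 0 < t) by (apply Rdiv_lt_0_compat; lra).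
    assert (HtB : B * t < 1 - B).
    { apply Rle_lt_trans with (Rabs B * t); [nra|].
      replace (1 - B) with ((2 * (Rabs B + 1)) * t) by (unfold t; field; lra). nra. }
    assert (H1 : 1 + t <= exp (B * t)).
    { eapply Rle_trans; [apply Hright; lra|]. apply HB. intros r Hr.
      pose proof (Hright (r * t) ltac:(nra)). nra. }
    pose proof (exp_ineq1_le (- (B * t))) as H2.
    assert (H3 : exp (B * t) * exp (- (B * t)) = 1)
      by (rewrite <- exp_plus, Rplus_opp_r; apply exp_0).
    assert (H4 : (1 + t) * (1 + - (B * t)) <= 1).
    { destruct (Rle_lt_dec 0 (1 + - (B * t))).
      - rewrite <- H3. apply Rmult_le_compat; lra.
      - nra. }
    nra. }
  assert (Hlim : forall x N, 0 < x -> x <= a -> (1 <= N)%nat ->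
            altsum a b x N <= Re (F (RtoC (- x)))).
  { intros x N Hx Hxa HN. apply altsum_le_limit; try lra; [exact HN|].
    apply altsum_converges, HF. }
  assert (Hleft : forall x, 0 < x -> x <= a ->
            (forall r, 0 < r <= x -> Re (F (RtoC (- r))) <> 0) ->
            Re (F (RtoC (- x))) <= exp (- x)).
  { intros x Hx Hxa Hr. apply Rle_trans with (exp (B * - x)).
    - apply HB. intros r Hr1. replace (r * - x) with (- (r * x)) by ring.
      apply Hr. nra.
    - destruct (Rle_lt_or_eq_dec (B * - x) (- x)) as [H|H]; [nra | |].
      + left; apply exp_increasing, H.
      + rewrite H; lra. }
  assert (Hsmall : forall x, 0 < x <= 1 -> 0 < Re (F (RtoC (- x)))).
  { intros x Hx. pose proof (Hlim x 2%nat ltac:(lra) ltac:(lra) ltac:(lia)).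
    pose proof (altsum_incr a b x 1 ltac:(lra) ltac:(lra) ltac:(lra) ltac:(lra) ltac:(lia)).
    rewrite altsum_1 in *. lra. }
  (* [1 - x + x^2 / a - x^3 / (a^2 b) <= 1 - x + x^2 / 2] is violated at
     [x = 1 / a - 1 / 2], because [a^2 b > 1] *)
  assert (Ha2 : 2 <= a).
  { apply Rnot_lt_le. intros Hlt.
    set (x := (/ a - / 2)).
    assert (Hx : 0 < x < 1).
    { unfold x. assert (/ 2 < / a) by (apply Rinv_lt_contravar; nra).
      assert (/ a < / 1) by (apply Rinv_lt_contravar; lra). lra. }
    pose proof (Hlim x 2%nat ltac:(lra) ltac:(lra) ltac:(lia)) as H1.
    pose proof (Hleft x ltac:(lra) ltac:(lra)
      ltac:(intros r Hr; pose proof (Hsmall r ltac:(lra)); lra)) as H2.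
    pose proof (exp_opp_le_quadratic x ltac:(lra)) as H3.
    rewrite altsum_2 in H1 by lra.
    assert (H4 : x ^ 3 / (a ^ 2 * b) < x ^ 3).
    { apply Rlt_div_l; [nra|].
      assert (1 < a ^ 2 * b) by nra. assert (0 < x ^ 3) by (apply pow_lt; lra). nra. }
    assert (H5 : x ^ 2 / a - x ^ 2 / 2 = x ^ 3) by (unfold x; field; lra).
    lra. }
  split; [exact Ha2|].
  assert (Hend : exp (- a) < Re (F (RtoC (- a)))).
  { eapply Rlt_le_trans; [apply (exp_neg_lt_altsum_3 a b); lra|]. apply Hlim; lra || lia. }
  destruct (classic (exists x, 0 < x <= a /\ Re (F (RtoC (- x))) = 0)) as [[x [Hx Hx0]]|Hno].
  - exists x.
    assert (Hx1 : 1 < x).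
    { apply Rnot_le_lt. intros H. pose proof (Hsmall x ltac:(lra)). lra. }
    assert (Hxa : x < a).
    { destruct Hx as [_ [H|H]]; [exact H|]. subst x. pose proof (exp_pos (- a)). lra. }
    split; [lra|]. intros N HN.
    pose proof (altsum_incr a b x N ltac:(lra) ltac:(lra) ltac:(lra) ltac:(lra) HN).
    pose proof (Hlim x (S N) ltac:(lra) ltac:(lra) ltac:(lia)). lra.
  - exfalso. pose proof (Hleft a ltac:(lra) ltac:(lra)) as H.
    assert (Re (F (RtoC (- a))) <= exp (- a)); [|lra].
    apply H. intros r Hr E. apply Hno. exists r; split; [lra | exact E].
Qed.

(** * Monotonicity in the two quotients *)

(** Exchanging [a] and [b] lowers the alternating sums when [a <= b], since it raises the
    first quotient and keeps the product. *)
Lemma LPI_of_negative_sums a b x f : 2 <= a -> a <= b -> 1 < x < a -> negative_sums a b x ->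
  is_f_ab a b f -> LPI f.
Proof.
  intros Ha Hab Hx Hneg Hf.
  apply (LPI_of_two_negative_sums a b x f); try lra; try assumption; [nra|].
  intros N HN. specialize (Hneg N HN).
  pose proof (altsum_le_of_lower_first b a a b x ltac:(lra) ltac:(lra) ltac:(lra) ltac:(lra)
    ltac:(lra) ltac:(nra) N ltac:(lra)). lra.
Qed.

Theorem theorem1p2 (q_infty : R) (Hq : is_q_infty q_infty)
    (a b : R) (f_ab : C -> C) (Ha : 1 < a) (Hab : a < b)
    (Hf : is_f_ab a b f_ab) :
  (LPI f_ab -> q_infty <= a)
  /\
  (q_infty <= a -> LPI f_ab ->
   forall (c : R) (f_ac : C -> C),
     a < c -> c < b -> is_f_ab a c f_ac -> LPI f_ac)
  /\
  (q_infty <= a -> LP f_ab ->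
   forall (d : R) (f_db : C -> C),
     a < d -> d < b -> is_f_ab d b f_db -> LPI f_db).
Proof.
  (* the case [c = a] is a partial theta function and serves for the first claim *)
  assert (Hsecond : LPI f_ab -> forall c f_ac, a <= c -> c <= b ->
            is_f_ab a c f_ac -> LPI f_ac).
  { intros HLP c f_ac Hac Hcb Hfc.
    destruct (negative_sums_of_LP a b f_ab Ha ltac:(lra) Hf (LPI_LP _ HLP)) as [Ha2 [x [Hx Hneg]]].
    apply (LPI_of_negative_sums a c x); try assumption.
    intros N HN. specialize (Hneg N HN).
    pose proof (altsum_le_of_lower_second a b a c x ltac:(lra) ltac:(lra) ltac:(lra)
      ltac:(nra) ltac:(lra) ltac:(nra) N eq_refl HN). lra. }
  split; [|split].
  - intros HLP.
    assert (Hs1 : 1 < sqrt a) by (rewrite <- sqrt_1; apply sqrt_lt_1_alt; lra).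
    assert (Hs2 : sqrt a ^ 2 = a) by (apply pow2_sqrt; lra).
    pose proof (partial_theta_is_f (sqrt a) Hs1) as Htheta. rewrite Hs2 in Htheta.
    rewrite <- Hs2 at 1. apply (proj1 (Hq _ Hs1)), LPI_LP.
    apply (Hsecond HLP a); try assumption; lra.
  - intros _ HLP c f_ac Hac Hcb. apply Hsecond; [exact HLP | lra | lra].
  - intros _ HLP d f_db Had Hdb Hfd.
    destruct (negative_sums_of_LP a b f_ab Ha ltac:(lra) Hf HLP) as [Ha2 [x [Hx Hneg]]].
    apply (LPI_of_negative_sums d b x); try assumption; try lra.
    intros N HN. specialize (Hneg N HN).
    pose proof (altsum_le_of_lower_first d b a b x ltac:(lra) ltac:(lra) ltac:(lra)
      ltac:(nra) ltac:(lra) ltac:(nra) N ltac:(lra)). lra.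
Qed.
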